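(* Assume that $A\neq0$, that there is $\nu>0$ with $\|A^{1/2}u\|^2\ge\nu\|u\|^2$ for all $u\in D(A^{1/2})\cap(\ker A)^\perp$, that $F$ satisfies (i)–(vi) of the context, and that $\gamma(t)=\alpha/t$ with $\frac{s+2}{s-2}\le\alpha\le2$. Fix $$0<\varepsilon<\min\left\{\frac1{4(s-2)},\frac12\right\},\qquad 0<\epsilon_1\le\min\left\{\frac1{s^2},\frac{s-2}{2s^2+3s+2}\right\}.$$ Let $(u_0,u_1)\in(\mathcal H_1\times\mathcal H)\setminus(\ker A\times\ker A)$, let $u$ be the unique global mild solution of the Cauchy problem in the context, and let $K>0$ be a constant with $M_0(r)\le K$ for all $0\le r\le\sqrt{2E(t_0)}$. Put $$\bar C_1=2^{s/2}R\,(K^{\frac{s-2}{s}}+1),\qquad \bar C_3=\frac{8\nu+8}{\nu}\bar C_1 .$$ Then there is a constant $C_\varepsilon>0$, independent of $E(t_0)$ and $t_0$ once the bound $K$ is fixed, such that if $t_6\ge t_0$ is large enough that $$t_6\ge\frac{\nu^2+2\nu+3}{\nu\epsilon_1}\alpha+\left[\frac{4\bar C_1}{\epsilon_1\alpha}\Big([H^*(t_0)]^{\frac{s-2}{s}}+[H^*(t_0)]^{\frac{s-2}{2}}\Big)\right]^{\frac s2}+\left(\frac{8\bar C_1}{\epsilon_1\alpha}\right)^{s}\left[\tilde H^*(t_0)+C_\varepsilon t_0^{\alpha-\frac{2s}{s-2}-2\varepsilon}\right]^{s-2}$$ and $$t_6\ge\left[2^{\frac{s}{s-2}}H^*(t_0)\right]^{\frac{s(s+2)}{2\alpha}}+(8s\bar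 C_3)^s+\frac{4\sqrt{2\nu+2}}{\nu},$$ then there is a constant $c>0$ such that $$E(t)\ge c\,t^{-\alpha},\qquad\forall t\ge t_6.$$
   Context: $\mathcal H$ is a real Hilbert space with scalar product $\langle\cdot,\cdot\rangle$ and norm $\|\cdot\|$; $A$ is a nonnegative self-adjoint operator on $\mathcal H$ with dense domain $D(A)$ (not assumed coercive); $\mathcal H_1=D(A^{1/2})$ with norm $\|v\|_{\mathcal H_1}=(\|v\|^2+\|A^{1/2}v\|^2)^{1/2}$. $P:\mathcal H\to\ker A$ is the orthogonal projection and $Q=I-P$. Assumptions on $F$: (i) $F:\mathcal H_1\to\mathbb R$ is nonnegative and differentiable with $F(0)=0$, and its gradient is a map $\nabla F:\mathcal H_1\to\mathcal H$ (so $F'(u)h=\langle\nabla F(u),h\rangle$ for $u,h\in\mathcal H_1$). (ii) $\|\nabla F(v)-\nabla F(w)\|\le L_0(\|v\|_{\mathcal H_1},\|w\|_{\mathcal H_1})\|v-w\|_{\mathcal H_1}$ for all $v,w\in\mathcal H_1$, where $L_0$ is a positive function on $\mathbb R^+\times\mathbb R^+$ bounded on bounded sets. (iii) There is a constant $s>2$ with $sF(u)\le\langle\nabla F(u),u\rangle$ for all $u\in\mathcal H_1$. (iv) There is a constant $L_1>0$ with $\|\nabla F(v)-\nabla F(w)\|\le L_1\|v-w\|_{\mathcal H_1}(\|v\|_{\mathcal H_1}^{s-2}+\|w\|_{\mathcal H_1}^{s-2})$ for all $v,w\in\mathcal H_1$. (v) There is a function $M_0:\mathbb R\to\mathbb R$,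 bounded on bounded sets, with $\|u\|^s\le M_0(\|A^{1/2}u\|)(\|A^{1/2}u\|^2+F(u))$ for all $u\in\mathcal H_1$. (vi) There is $R>0$ with $\|Q\nabla F(u)\|\le R(\|u\|^{s-2}+\|A^{1/2}u\|^{s-2})\|A^{1/2}u\|$ for all $u\in\mathcal H_1$. The number $s$ is the same in (iii)–(vi). Cauchy problem: $u''(t)+Au(t)+\gamma(t)u'(t)+\nabla F(u(t))=0$ for $t\ge t_0$, $u(t_0)=u_0$, $u'(t_0)=u_1$, where $t_0>0$ and $\gamma(t)=\alpha/t$. A mild solution is $u\in C([t_0,\infty);\mathcal H_1)\cap C^1([t_0,\infty);\mathcal H)$ with $$u(t)=S'(t-t_0)u_0+S(t-t_0)u_1-\int_{t_0}^tS(t-\tau)[\gamma(\tau)u'(\tau)+\nabla F(u(\tau))]\,d\tau,$$ where $S(\cdot)$ is the solution operator of $u''+Au=0$ with $S(0)=0$, $S'(0)=I$. For each $(u_0,u_1)\in\mathcal H_1\times\mathcal H$ a unique global mild solution exists. Energy: $E(t)=\frac12\|u'(t)\|^2+\frac12\|A^{1/2}u(t)\|^2+F(u(t))$; it is non-increasing, so $\|A^{1/2}u(t)\|\le\sqrt{2E(t_0)}$ for $t\ge t_0$. For $\lambda>0$, $\eta\in\mathbb R$ and $\xi=\lambda(\lambda+1-\alpha)$ set $E_\lambda(t)=t^2F(u(t))+\frac12\|\lambda u(t)+tu'(t)\|^2+\frac\xi2\|u(t)\|^2+\frac{t^2}2\|A^{1/2}u(t)\|^2$ and $H(t)=t^\eta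 E_\lambda(t)$. $H^*(t_0)$ denotes $H(t_0)$ with $\eta=\alpha-2$, $\lambda=\frac\alpha2$; $\tilde H^*(t_0)$ denotes $H(t_0)$ with $\eta=\alpha-2-2\varepsilon$, $\lambda=\frac\alpha2+\varepsilon$. *)

(* Defs.v *)
From Stdlib Require Import Reals.
From Coquelicot Require Import Coquelicot.

Open Scope R_scope.

(* Real power with the convention 0^y = 0 (only used at base 0 with y > 0);
   Stdlib's [Rpower] returns 1 at base 0. *)
Definition rpow (x y : R) : R :=
  if Rlt_dec 0 x then Rpower x y else 0.

Record HilbertSpace := {
  hcarrier :> CompleteNormedModule R_AbsRing;
  inner : hcarrier -> hcarrier -> R;
  inner_sym : forall x y, inner x y = inner y x;
  inner_plus_l : forall x y z,
    inner (plus x y) z = inner x z + inner y z;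
  inner_scal_l : forall (a : R) x y, inner (scal a x) y = a * inner x y;
  inner_ge0 : forall x, 0 <= inner x x;
  norm_inner : forall x, norm x = sqrt (inner x x)
}.

Arguments inner {h} _ _.

(* The values of [op] outside [dom] are junk. *)
Record operator (H : HilbertSpace) := {
  dom : H -> Prop;
  op :> H -> H;
  dom_zero : dom zero;
  dom_plus : forall x y, dom x -> dom y -> dom (plus x y);
  dom_scal : forall (a : R) x, dom x -> dom (scal a x);
  op_plus : forall x y, dom x -> dom y -> op (plus x y) = plus (op x) (op y);
  op_scal : forall (a : R) x, dom x -> op (scal a x) = scal a (op x)
}.

Arguments dom {H} _ _.
Arguments op {H} _ _.

Section Operators.
Context {H : HilbertSpace}.
Implicit Types A B : operator H.

Definition densely_defined A : Prop :=
  forall (x : H) (e : R), 0 < e -> exists y, dom A y /\ norm (minus x y) < e.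

(* The graph of A coincides with the graph of its adjoint. *)
Definition self_adjoint A : Prop :=
  forall x y : H,
    (forall z, dom A z -> inner (A z) x = inner z y) <-> (dom A x /\ A x = y).

Definition nonneg_self_adjoint A : Prop :=
  densely_defined A /\ self_adjoint A /\
  (forall x, dom A x -> 0 <= inner (A x) x).

(* B = A^{1/2}: the nonnegative self-adjoint B with B B = A, domains included. *)
Definition is_sqrt_operator A B : Prop :=
  nonneg_self_adjoint B /\
  (forall x, dom A x <-> (dom B x /\ dom B (B x))) /\
  (forall x, dom A x -> A x = B (B x)).

Definition nonzero_operator A : Prop := exists x, dom A x /\ A x <> zero.

Definition ker A (v : H) : Prop := dom A v /\ A v = zero.

Definition orthogonal_to (V : H -> Prop) (x : H) : Prop :=
  forall w, V w -> inner x w = 0.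

Definition is_orthogonal_projection (V : H -> Prop) (P : H -> H) : Prop :=
  forall x, V (P x) /\ orthogonal_to V (minus x (P x)).

(* With B = A^{1/2}, H_1 is [dom B] with the following norm. *)
Definition norm1 B (v : H) : R := sqrt (norm v ^ 2 + norm (B v) ^ 2).

(* S is the solution operator of u'' + A u = 0 with S(0) = 0, S'(0) = I, and
   S' is its time derivative: S(t)v = A^{-1/2} sin(t A^{1/2}) v and
   S'(t)v = cos(t A^{1/2}) v.  For v in D(A^{1/2}), t |-> S(t)v is a classical
   solution; general v are reached by boundedness of S(t) and density. *)
Record solution_operator A B (S S' : R -> H -> H) : Prop := {
  S_bounded : forall t, is_linear (S t);
  S'_bounded : forall t, is_linear (S' t);
  S_zero : forall v, S 0 v = zero;
  S'_zero : forall v, S' 0 v = v;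
  S_derive : forall v t, is_derive (fun r => S r v) t (S' t v);
  S'_continuous : forall v t, continuous (fun r => S' r v) t;
  S_dom : forall v t, dom B v -> dom A (S t v);
  S_wave : forall v t, dom B v ->
    is_derive (fun r => S' r v) t (opp (A (S t v)));
  S_wave_continuous : forall v t, dom B v -> continuous (fun r => A (S r v)) t
}.

(* F and gradF are total, but only their values on H_1 = dom B matter below. *)

(* Frechet differentiability for the H_1 norm, with gradient in H. *)
Definition F_differentiable B (F : H -> R) (gradF : H -> H) : Prop :=
  (forall u, dom B u -> 0 <= F u) /\
  F zero = 0 /\
  (forall u, dom B u ->
     forall e, 0 < e -> exists d, 0 < d /\
       forall h, dom B h -> norm1 B h < d ->
         Rabs (F (plus u h) - F u - inner (gradF u) h) <= e * norm1 B h).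

Definition F_locally_lipschitz B (gradF : H -> H) : Prop :=
  exists L0 : R -> R -> R,
    (forall a b, 0 <= a -> 0 <= b -> 0 < L0 a b) /\
    (forall r, exists M, forall a b,
       0 <= a <= r -> 0 <= b <= r -> L0 a b <= M) /\
    (forall v w, dom B v -> dom B w ->
       norm (minus (gradF v) (gradF w))
         <= L0 (norm1 B v) (norm1 B w) * norm1 B (minus v w)).

Definition F_superquadratic B (F : H -> R) (gradF : H -> H) (s : R) : Prop :=
  2 < s /\ (forall u, dom B u -> s * F u <= inner (gradF u) u).

Definition F_growth B (gradF : H -> H) (s : R) : Prop :=
  exists L1, 0 < L1 /\
    forall v w, dom B v -> dom B w ->
      norm (minus (gradF v) (gradF w))
        <= L1 * norm1 B (minus v w)
             * (rpow (norm1 B v) (s - 2) + rpow (norm1 B w) (s - 2)).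

Definition F_coercive B (F : H -> R) (s : R) (M0 : R -> R) : Prop :=
  (forall r, exists M, forall x, Rabs x <= r -> Rabs (M0 x) <= M) /\
  (forall u, dom B u ->
     rpow (norm u) s <= M0 (norm (B u)) * (norm (B u) ^ 2 + F u)).

Definition F_range_part B (P gradF : H -> H) (s Rc : R) : Prop :=
  0 < Rc /\
  forall u, dom B u ->
    norm (minus (gradF u) (P (gradF u)))
      <= Rc * (rpow (norm u) (s - 2) + rpow (norm (B u)) (s - 2)) * norm (B u).

Definition F_assumptions B (P : H -> H) (F : H -> R) (gradF : H -> H)
    (s : R) (M0 : R -> R) (Rc : R) : Prop :=
  F_differentiable B F gradF /\
  F_locally_lipschitz B gradF /\
  F_superquadratic B F gradF s /\
  F_growth B gradF s /\
  F_coercive B F s M0 /\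
  F_range_part B P gradF s Rc.

(* Neighbourhoods of t in [t0, +oo); derivatives at t0 are one-sided. *)
Definition at_from (t0 t : R) : (R -> Prop) -> Prop :=
  within (fun r => t0 <= r) (locally t).

(* [du] is the derivative u' of u on [t0, +oo). *)
Record mild_solution B (S S' : R -> H -> H) (gradF : H -> H)
    (gam : R -> R) (t0 : R) (u0 u1 : H) (u du : R -> H) : Prop := {
  mild_dom : forall t, t0 <= t -> dom B (u t);
  mild_continuous : forall t, t0 <= t ->
    filterlim (fun r => norm1 B (minus (u r) (u t))) (at_from t0 t) (locally 0);
  mild_derive : forall t, t0 <= t ->
    filterdiff u (at_from t0 t) (fun h : R => scal h (du t));
  mild_derive_continuous : forall t, t0 <= t ->
    filterlim du (at_from t0 t) (locally (du t));
  mild_duhamel : forall t, t0 <= t -> exists I : H,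
    is_RInt (fun r => S (t - r) (plus (scal (gam r) (du r)) (gradF (u r))))
      t0 t I /\
    u t = minus (plus (S' (t - t0) u0) (S (t - t0) u1)) I
}.

Definition energy B (F : H -> R) (u du : R -> H) (t : R) : R :=
  1 / 2 * norm (du t) ^ 2 + 1 / 2 * norm (B (u t)) ^ 2 + F (u t).

Definition E_lambda B (F : H -> R) (u du : R -> H) (alpha lambda t : R) : R :=
  let xi := lambda * (lambda + 1 - alpha) in
  t ^ 2 * F (u t)
  + 1 / 2 * norm (plus (scal lambda (u t)) (scal t (du t))) ^ 2
  + xi / 2 * norm (u t) ^ 2
  + t ^ 2 / 2 * norm (B (u t)) ^ 2.

Definition H_fun B (F : H -> R) (u du : R -> H)
    (alpha eta lambda t : R) : R :=
  rpow t eta * E_lambda B F u du alpha lambda t.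

Definition H_star B (F : H -> R) (u du : R -> H) (alpha t : R) : R :=
  H_fun B F u du alpha (alpha - 2) (alpha / 2) t.

Definition H_star_tilde B (F : H -> R) (u du : R -> H)
    (alpha eps t : R) : R :=
  H_fun B F u du alpha (alpha - 2 - 2 * eps) (alpha / 2 + eps) t.

End Operators.

Definition C1bar (s Rc K : R) : R :=
  rpow 2 (s / 2) * Rc * (rpow K ((s - 2) / s) + 1).

Definition C3bar (nu s Rc K : R) : R :=
  (8 * nu + 8) / nu * C1bar s Rc K.

(* Main.v *)
(** The solution itself may enter the constant [c], so it suffices to show that
    [n = |Qu'|^2 + |A^(1/2) u|^2], which is at most [2 E], satisfies
    [n >= c t^(-alpha)].  For
    [lambda = alpha/2] the functional [t^(alpha-2) E_lambda(t)] is nonincreasing,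
    hence [|A^(1/2) u|^2 + F(u) = O(t^(-alpha))], and (v), (vi) give
    [|Q grad F(u)| <= C t^(-p) |A^(1/2) u|] with
    [p = alpha (s-2)/s >= 1 + 2/s > 1].  So [v = Qu] solves a linear damped wave
    equation with an integrable perturbation.  The first order terms cancel in
    the derivative of [L = t^alpha (n + (alpha/t) <v',v>)], which leaves
    [L' >= -g L] with [g] integrable at infinity; as [n] cannot vanish unless
    the data lie in [ker A x ker A], [L] stays above a positive constant.
    The identities for mild solutions behind these computations are proved for
    time averages of [u], which take values in [D(A)]. *)

Require Import Defs.
From Stdlib Require Import Reals Lra Psatz.
From Coquelicot Require Import Coquelicot.
Open Scope R_scope.

(** * Inner product calculus *)

(** The cancellation is equipartition of energy. With [q = |Qu'|^2] and [d = |A^(1/2) u|^2], damping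
    alone gives [(t^alpha n)' = alpha t^(alpha-1) (d - q)], which has no sign; by the virial
    identity for [<v',v>] the corrector contributes the opposite term. The spectral gap bounds [|v|]
    by a multiple of [|A^(1/2) u|], so the corrector is dominated by [n] for large [t]; before that
    a cruder exponential bound keeps [n] positive. The lower bound on [alpha] is exactly
    [alpha (s-2)/s >= 1 + 2/s]; the upper bound gives the remaining term in the derivative of the
    decaying functional its sign.

    The obstacle is regularity: [u] lies only in the domain of [A^(1/2)] and [u'] only in [H], so
    the equation cannot simply be multiplied by [u'] or [u]. Duhamel's formula is paired with [z] in
    [D(A)] and the propagators are moved onto [z], where they can be differentiated; this is a weak
    equation. Integrated in time, it puts the averages of [u] into [D(A)] by self-adjointness. The
    potential needs its own chain rule, since [F] is differentiable for the [H_1] norm and [u] only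
    in [H]. *)

Section Inner.
Context {H : HilbertSpace}.
Implicit Types x y z : H.

Lemma inner_plus_r x y z : inner x (plus y z) = inner x y + inner x z.
Proof. now rewrite inner_sym, inner_plus_l, !(inner_sym _ _ x). Qed.

Lemma inner_scal_r (a : R) x y : inner x (scal a y) = a * inner x y.
Proof. now rewrite inner_sym, inner_scal_l, inner_sym. Qed.

Lemma inner_opp_l x y : inner (opp x) y = - inner x y.
Proof.
replace (opp x) with (scal (opp one) x) by apply @scal_opp_one.
rewrite inner_scal_l; unfold opp, one; simpl; ring.
Qed.

Lemma inner_opp_r x y : inner x (opp y) = - inner x y.
Proof. now rewrite inner_sym, inner_opp_l, inner_sym. Qed.

Lemma inner_minus_l x y z : inner (minus x y) z = inner x z - inner y z.
Proof. unfold minus; rewrite inner_plus_l, inner_opp_l; ring. Qed.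

Lemma inner_minus_r x y z : inner x (minus y z) = inner x y - inner x z.
Proof. now rewrite inner_sym, inner_minus_l, !(inner_sym _ _ x). Qed.

Lemma inner_zero_l x : inner zero x = 0.
Proof.
transitivity (inner (scal 0 x) x); [|rewrite inner_scal_l; ring].
f_equal; symmetry; exact (scal_zero_l x).
Qed.

Lemma inner_zero_r x : inner x zero = 0.
Proof. now rewrite inner_sym, inner_zero_l. Qed.

Lemma norm_sq x : norm x ^ 2 = inner x x.
Proof.
rewrite norm_inner; simpl; rewrite Rmult_1_r, sqrt_sqrt; auto.
apply inner_ge0.
Qed.

Lemma inner_self_eq0 x : inner x x = 0 -> x = zero.
Proof. intros E; apply (norm_eq_zero (V := H)); rewrite norm_inner, E; apply sqrt_0. Qed.

Lemma eq_of_inner_minus x y : inner (minus x y) (minus x y) = 0 -> x = y.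
Proof.
intros E; apply inner_self_eq0 in E; apply (plus_reg_r (opp y)).
rewrite plus_opp_r; exact E.
Qed.

Lemma inner_ext x y : (forall z, inner x z = inner y z) -> x = y.
Proof. intros E; apply eq_of_inner_minus; rewrite inner_minus_l, E; ring. Qed.

Lemma Cauchy_Schwarz x y : Rabs (inner x y) <= norm x * norm y.
Proof.
assert (Hx := norm_ge_0 x); assert (Hy := norm_ge_0 y).
rewrite <- (Rabs_pos_eq (norm x * norm y)) by nra.
apply Rsqr_le_abs_0; unfold Rsqr.
replace (norm x * norm y * (norm x * norm y)) with (norm x ^ 2 * norm y ^ 2) by ring.
rewrite !norm_sq.
assert (Hq : 0 <= inner y y * (inner x x * inner y y - inner x y * inner x y)).
{ assert (K := inner_ge0 _ (minus (scal (inner y y) x) (scal (inner x y) y))).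
  rewrite inner_minus_l, !inner_minus_r, !inner_scal_l, !inner_scal_r,
    (inner_sym _ y x) in K.
  nra. }
destruct (Rle_lt_or_eq_dec _ _ (inner_ge0 _ y)) as [P|E].
- nra.
- rewrite (inner_self_eq0 y), inner_zero_r, inner_zero_l by auto; lra.
Qed.

Lemma norm_plus_le x y : norm (plus x y) <= norm x + norm y.
Proof. exact (norm_triangle x y). Qed.

Lemma norm_scal_abs (a : R) x : norm (scal a x) = Rabs a * norm x.
Proof.
rewrite !norm_inner, inner_scal_l, inner_scal_r, <- Rmult_assoc.
rewrite sqrt_mult; [|nra|apply inner_ge0]; f_equal; apply sqrt_Rsqr_abs.
Qed.

Lemma norm_eq_sqrt_sq x : norm x = sqrt (norm x ^ 2).
Proof. symmetry; rewrite <- Rsqr_pow2; apply sqrt_Rsqr, norm_ge_0. Qed.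

End Inner.

(* Coquelicot's operations reach a Hilbert space through several convertible
   but syntactically different canonical structures; the casts below select
   the instance found in the goal. *)
Ltac inner_expand := repeat match goal with
  | |- context [@inner ?h ?u ?v] =>
    let t := constr:(@inner h u v) in
    match u with
    | @plus _ ?x ?y => rewrite (inner_plus_l h x y v : t = @inner h x v + @inner h y v)
    | @minus _ ?x ?y => rewrite (@inner_minus_l h x y v : t = @inner h x v - @inner h y v)
    | @opp _ ?x => rewrite (@inner_opp_l h x v : t = - @inner h x v)
    | @scal _ _ ?a ?x => rewrite (inner_scal_l h a x v : t = a * @inner h x v)
    | @zero _ => rewrite (@inner_zero_l h v : t = 0)
    end
  | |- context [@inner ?h ?u ?v] =>
    let t := constr:(@inner h u v) in
    match v with
    | @plus _ ?x ?y => rewrite (@inner_plus_r h u x y : t = @inner h u x + @inner h u y)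
    | @minus _ ?x ?y => rewrite (@inner_minus_r h u x y : t = @inner h u x - @inner h u y)
    | @opp _ ?x => rewrite (@inner_opp_r h u x : t = - @inner h u x)
    | @scal _ _ ?a ?x => rewrite (@inner_scal_r h a u x : t = a * @inner h u x)
    | @zero _ => rewrite (@inner_zero_r h u : t = 0)
    end
  end.

(* An equation between vectors reduces to the identity satisfied by their
   inner products with an arbitrary vector. *)
Ltac vec := apply inner_ext; let z := fresh in intros z; inner_expand; try ring.

(** * Limits and derivatives of inner products *)

Section InnerLimits.
Context {H : HilbertSpace}.

(** Polarization reduces joint continuity to the continuity of the norm and of the vector
    operations. *)
Lemma filterlim_inner {T : Type} (G : (T -> Prop) -> Prop) {FG : Filter G}
    (f g : T -> H) (x y : H) :
  filterlim f G (locally x) -> filterlim g G (locally y) ->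
  filterlim (fun t => inner (f t) (g t)) G (locally (inner x y)).
Proof.
intros Hf Hg.
assert (Sq : forall (k : T -> H) w, filterlim k G (locally w) ->
  filterlim (fun t => norm (k t) ^ 2) G (locally (norm w ^ 2))).
{ intros k w Hk; simpl; rewrite Rmult_1_r.
  apply filterlim_ext with (fun t => norm (k t) * norm (k t)).
  - intros t; ring.
  - assert (N : filterlim (fun t => norm (k t)) G (locally (norm w)))
      by exact (filterlim_comp _ _ _ _ _ _ _ _ Hk (filterlim_norm w)).
    exact (filterlim_comp_2 _ _ _ N N (filterlim_mult (norm w) (norm w))). }
assert (Polar : forall a b : H,
  inner a b = / 4 * (norm (plus a b) ^ 2 - norm (plus a (opp b)) ^ 2)).
{ intros a b; rewrite !norm_sq, !inner_plus_l, !inner_plus_r, !inner_opp_l,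
    !inner_opp_r, (inner_sym _ b a); field. }
rewrite Polar.
apply filterlim_ext with (fun t =>
  / 4 * (norm (plus (f t) (g t)) ^ 2 - norm (plus (f t) (opp (g t))) ^ 2)).
{ intros t; now rewrite (Polar (f t)). }
assert (S1 := Sq _ _ (filterlim_comp_2 _ _ _ Hf Hg (filterlim_plus x y))).
assert (Ho : filterlim (fun t => opp (g t)) G (locally (opp y)))
  by exact (filterlim_comp _ _ _ _ _ _ _ _ Hg (filterlim_opp y)).
assert (S2 := Sq _ _ (filterlim_comp_2 _ _ _ Hf Ho (filterlim_plus x (opp y)))).
assert (S3 := filterlim_comp _ _ _ _ _ _ _ _ S2
  (filterlim_opp (norm (plus x (opp y)) ^ 2))).
assert (S4 := filterlim_comp_2 _ _ _ S1 S3 (filterlim_plus _ _)).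
exact (filterlim_comp _ _ _ _ _ _ _ _ S4 (filterlim_scal_r (/4) _)).
Qed.

Lemma continuous_inner {T : UniformSpace} (f g : T -> H) t :
  continuous f t -> continuous g t -> continuous (fun r => inner (f r) (g r)) t.
Proof. intros Hf Hg; apply (filterlim_inner (locally t)); assumption. Qed.

Lemma is_derive_remainder {V : NormedModule R_AbsRing} (f : R -> V) t l :
  is_derive f t l <->
  forall e, 0 < e -> locally t (fun r =>
    norm (minus (minus (f r) (f t)) (scal (r - t) l)) <= e * Rabs (r - t)).
Proof.
split.
- intros [_ D] e He; exact (D t (fun P HP => HP) (mkposreal e He)).
- intros D; split; [apply is_linear_scal_l |].
  intros x Hx e.
  rewrite <- (is_filter_lim_locally_unique _ _ Hx).
  exact (D e (cond_pos e)).
Qed.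

Lemma is_derive_continuous {V : NormedModule R_AbsRing} (f : R -> V) t l :
  is_derive f t l -> continuous f t.
Proof. intros D; apply ex_derive_continuous; now exists l. Qed.

Lemma is_derive_eq (f : R -> R) (t l l' : R) : is_derive f t l -> l = l' -> is_derive f t l'.
Proof. now intros D <-. Qed.

Lemma is_derive_inner (f g : R -> H) t f' g' :
  is_derive f t f' -> is_derive g t g' ->
  is_derive (fun r => inner (f r) (g r)) t (inner f' (g t) + inner (f t) g').
Proof.
intros Df Dg; assert (Cg := is_derive_continuous _ _ _ Dg).
apply is_derive_remainder; intros e He.
assert (E : forall v : H, 0 < e / (3 * (norm v + 1))).
{ intros v; assert (Hv := norm_ge_0 v); apply Rdiv_lt_0_compat; lra. }
assert (Cg1 : locally t (fun r => norm (minus (g r) (g t)) < Rmin 1 (e / (3 * (norm f' + 1))))).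
{ assert (P : 0 < Rmin 1 (e / (3 * (norm f' + 1)))) by (apply Rmin_glb_lt; auto; lra).
exact (proj1 (filterlim_locally_ball_norm _ _) Cg (mkposreal _ P)). }
generalize (filter_and _ _ Cg1 (filter_and _ _
  (proj1 (is_derive_remainder _ _ _) Df _ (E (g t)))
  (proj1 (is_derive_remainder _ _ _) Dg _ (E (f t))))).
apply filter_imp; intros r [H1 [H2 H3]].
set (Rf := minus (minus (f r) (f t)) (scal (r - t) f')) in *.
set (Rg := minus (minus (g r) (g t)) (scal (r - t) g')) in *.
(* Exact form of the remainder of the product. Each of its three terms receives a third of [e]; the
   [+ 1] in the denominators covers vanishing vectors. *)
replace (minus _ _) with
  (inner Rf (g r) + inner (f t) Rg + (r - t) * inner f' (minus (g r) (g t))).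
2:{ unfold Rf, Rg; inner_expand.
  unfold minus, plus, opp, scal; simpl; unfold mult; simpl; ring. }
assert (N1 : norm (g r) <= norm (g t) + 1).
{ replace (g r) with (plus (g t) (minus (g r) (g t))) by vec.
  eapply Rle_trans; [apply norm_plus_le|].
  assert (K := Rmin_l 1 (e / (3 * (norm f' + 1)))); lra. }
assert (N2 : norm (minus (g r) (g t)) <= e / (3 * (norm f' + 1))).
{ assert (K := Rmin_r 1 (e / (3 * (norm f' + 1)))); lra. }
unfold norm at 1; simpl; unfold abs; simpl.
assert (Pt := Rabs_pos (r - t)).
assert (T1 : Rabs (inner Rf (g r)) <= e / 3 * Rabs (r - t)).
{ eapply Rle_trans; [apply Cauchy_Schwarz|].
  eapply Rle_trans; [apply Rmult_le_compat; [apply norm_ge_0 | apply norm_ge_0 | apply H2 | apply N1]|].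
  right; assert (Hv := norm_ge_0 (g t)); field; lra. }
assert (T2 : Rabs (inner (f t) Rg) <= e / 3 * Rabs (r - t)).
{ eapply Rle_trans; [apply Cauchy_Schwarz|].
  assert (Hv := norm_ge_0 (f t)).
  eapply Rle_trans; [apply Rmult_le_compat; [apply norm_ge_0 | apply norm_ge_0 | | apply H3]|].
  - apply Rle_trans with (norm (f t) + 1); [lra | apply Rle_refl].
  - right; field; lra. }
assert (T3 : Rabs ((r - t) * inner f' (minus (g r) (g t))) <= e / 3 * Rabs (r - t)).
{ rewrite Rabs_mult, Rmult_comm; apply Rmult_le_compat_r; auto.
  eapply Rle_trans; [apply Cauchy_Schwarz|].
  assert (Hv := norm_ge_0 f').
  eapply Rle_trans; [apply Rmult_le_compat; [apply norm_ge_0 | apply norm_ge_0 | | apply N2]|].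
  - apply Rle_trans with (norm f' + 1); [lra | apply Rle_refl].
  - right; field; lra. }
eapply Rle_trans; [apply Rabs_triang|].
eapply Rle_trans; [apply Rplus_le_compat_r, Rabs_triang|].
lra.
Qed.

Lemma is_derive_inner_l (f : R -> H) t f' z :
  is_derive f t f' -> is_derive (fun r => inner (f r) z) t (inner f' z).
Proof.
intros D.
assert (K := is_derive_inner f (fun _ => z) t f' zero D (is_derive_const z t)).
revert K; inner_expand; now rewrite Rplus_0_r.
Qed.

End InnerLimits.

(** * Symmetry and density for self-adjoint operators *)

Section SelfAdjoint.
Context {H : HilbertSpace} (T : operator H).

Lemma dom_minus x y : dom T x -> dom T y -> dom T (minus x y).
Proof.
intros Hx Hy; apply dom_plus; auto.
replace (opp y) with (scal (-1) y) by vec.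
now apply dom_scal.
Qed.

Lemma op_minus x y : dom T x -> dom T y -> T (minus x y) = minus (T x) (T y).
Proof.
intros Hx Hy; replace (minus x y) with (plus x (scal (-1) y)) by vec.
rewrite op_plus, op_scal; auto using dom_scal; vec.
Qed.

Lemma op_zero : T zero = zero.
Proof.
transitivity (T (scal 0 zero)).
- f_equal; vec.
- transitivity (scal 0 (T zero)); [apply op_scal, dom_zero | vec].
Qed.

Hypothesis hT : nonneg_self_adjoint T.

Lemma op_sym x y : dom T x -> dom T y -> inner (T x) y = inner x (T y).
Proof.
intros Hx Hy; destruct hT as [_ [SA _]].
exact (proj2 (SA y (T y)) (conj Hy eq_refl) x Hx).
Qed.

(** If [L x] were nonzero, a domain vector within [|L x| / (|M| + 1)] of [x] would give
    [|L x| < |L x|]. Only additivity and a bound are asked of [L], so that either slot of a bilinear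
    expression can be extended from the dense domain. *)
Lemma dense_bounded_zero (L : H -> R) (M : R) :
  (forall x y, L (minus x y) = L x - L y) ->
  (forall x, Rabs (L x) <= M * norm x) ->
  (forall z, dom T z -> L z = 0) -> forall x, L x = 0.
Proof.
intros HL HM HZ x; destruct hT as [De _].
destruct (Req_dec (L x) 0) as [|N]; auto; exfalso.
apply Rabs_pos_lt in N.
assert (PM : 0 < Rabs M + 1) by (assert (K := Rabs_pos M); lra).
destruct (De x (Rabs (L x) / (Rabs M + 1))) as [y [Hy Ly]].
{ apply Rdiv_lt_0_compat; lra. }
assert (K := HM (minus x y)); rewrite HL, (HZ y Hy), Rminus_0_r in K.
assert (Nn := norm_ge_0 (minus x y)).
assert (K2 : M * norm (minus x y) <= (Rabs M + 1) * norm (minus x y)).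
{ apply Rmult_le_compat_r; [exact Nn|]; assert (K2 := Rle_abs M); lra. }
apply (Rmult_lt_compat_l (Rabs M + 1)) in Ly; auto.
replace ((Rabs M + 1) * (Rabs (L x) / (Rabs M + 1))) with (Rabs (L x)) in Ly by (field; lra).
change (Rabs (L x) <= M * @norm R_AbsRing H (@minus H x y)) in K.
change ((Rabs M + 1) * @norm R_AbsRing H (@minus H x y) < Rabs (L x)) in Ly.
lra.
Qed.

Lemma dense_ext x y : (forall z, dom T z -> inner x z = inner y z) -> x = y.
Proof.
intros E; apply inner_ext; intros z; apply Rminus_diag_uniq.
apply dense_bounded_zero with (L := fun z => inner x z - inner y z) (M := norm x + norm y).
- intros a b; inner_expand; ring.
- intros a.
  eapply Rle_trans; [apply Rabs_triang|]; rewrite Rabs_Ropp, Rmult_plus_distr_r.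
  apply Rplus_le_compat; apply Cauchy_Schwarz.
- intros a Ha; rewrite E by auto; ring.
Qed.

End SelfAdjoint.

(** * Shifts and reflections of the time variable *)

Lemma continuous_opp_arg {V : UniformSpace} (f : R -> V) (a t : R) :
  continuous f (a - t) -> continuous (fun r => f (a - r)) t.
Proof.
intros C; apply (continuous_comp (fun r => a - r) f); auto.
apply (continuous_minus (V := R_NormedModule) (fun _ => a) (fun r => r));
  [apply continuous_const | apply continuous_id].
Qed.

Lemma is_derive_shift {V : NormedModule R_AbsRing} (f : R -> V) (a t : R) l :
  is_derive f (t - a) l -> is_derive (fun r => f (r - a)) t l.
Proof.
intros D.
assert (K : is_derive (fun r : R => r - a) t 1) by (auto_derive; auto).
assert (E := is_derive_comp f (fun r => r - a) t l 1 D K).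
now replace l with (scal 1 l) by exact (scal_one l).
Qed.

Lemma is_derive_reflect {V : NormedModule R_AbsRing} (f : R -> V) (a t : R) l :
  is_derive f (a - t) l -> is_derive (fun r => f (a - r)) t (opp l).
Proof.
intros D.
assert (K : is_derive (fun r : R => a - r) t (-1)) by (auto_derive; auto; ring).
assert (E := is_derive_comp f (fun r => a - r) t l (-1) D K).
now replace (opp l) with (scal (-1) l) by exact (scal_opp_one l).
Qed.

Lemma constant_of_derive_zero {V : NormedModule R_AbsRing} (f : R -> V) :
  (forall t, is_derive f t zero) -> forall a b, f a = f b.
Proof.
intros D a b; destruct (Rtotal_order a b) as [L|[->|L]]; auto.
- apply eq_is_derive; auto.
- symmetry; apply eq_is_derive; auto.
Qed.

(** * The propagator *)

Section Propagator.
Context {H : HilbertSpace} (A B : operator H) (S S' : R -> H -> H).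
Hypothesis hA : nonneg_self_adjoint A.
Hypothesis hB : is_sqrt_operator A B.
Hypothesis hS : solution_operator A B S S'.

Lemma dom_sqrt x : dom A x -> dom B x.
Proof. destruct hB as [_ [D _]]; intros Hx; exact (proj1 (proj1 (D x) Hx)). Qed.

Lemma sqrt_form x y : dom A x -> dom B y -> inner (A x) y = inner (B x) (B y).
Proof.
destruct hB as [SB [D E]]; intros Hx Hy.
rewrite (E x Hx); apply op_sym; auto; apply D; auto.
Qed.

(* The Wronskian [<S(t-r)x, S'(r)y> + <S'(t-r)x, S(r)y>] does not depend on
   [r]; compare its values at [0] and [t]. *)
Lemma S_sym_dom t x y : dom B x -> dom B y -> inner (S t x) y = inner x (S t y).
Proof.
intros Hx Hy.
set (W := fun r => inner (S (t - r) x) (S' r y) + inner (S' (t - r) x) (S r y)).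
assert (D : forall r, is_derive W r 0).
{ intros r.
  assert (D1 := is_derive_inner _ _ r _ _
    (is_derive_reflect (fun r => S r x) t r _ (S_derive _ _ _ _ hS x (t - r)))
    (S_wave _ _ _ _ hS y r Hy)).
  assert (D2 := is_derive_inner _ _ r _ _
    (is_derive_reflect (fun r => S' r x) t r _ (S_wave _ _ _ _ hS x (t - r) Hx))
    (S_derive _ _ _ _ hS y r)).
  assert (D3 := is_derive_plus _ _ _ _ _ D1 D2).
  refine (is_derive_eq _ _ _ _ D3 _).
  unfold plus; simpl; inner_expand.
  rewrite (op_sym A hA (S (t - r) x) (S r y)) by (apply (S_dom _ _ _ _ hS); auto).
  ring. }
assert (E := constant_of_derive_zero W D 0 t); unfold W in E.
rewrite Rminus_0_r, Rminus_diag, !(S_zero _ _ _ _ hS), !(S'_zero _ _ _ _ hS) in E.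
revert E; inner_expand; lra.
Qed.

Lemma S_minus t x y : S t (minus x y) = minus (S t x) (S t y).
Proof.
assert (L := S_bounded _ _ _ _ hS t).
replace (minus x y) with (plus x (scal (-1) y)) by vec.
rewrite (linear_plus _ L), (linear_scal _ L); vec.
Qed.

Lemma S_sym t x y : inner (S t x) y = inner x (S t y).
Proof.
destruct (linear_norm _ (S_bounded _ _ _ _ hS t)) as [M [M0 HM]].
assert (SB := proj1 hB).
assert (Bd : forall u v, Rabs (inner (S t u) v - inner u (S t v)) <= 2 * M * (norm u * norm v)).
{ intros u v; eapply Rle_trans; [apply Rabs_triang|]; rewrite Rabs_Ropp.
  replace (2 * M * (norm u * norm v))
    with ((M * norm u) * norm v + norm u * (M * norm v)) by ring.
  apply Rplus_le_compat; (eapply Rle_trans; [apply Cauchy_Schwarz|]).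
  - apply Rmult_le_compat_r; [apply norm_ge_0 | apply HM].
  - apply Rmult_le_compat_l; [apply norm_ge_0 | apply HM]. }
(* Density is used once per slot: here [v] stays in the domain and [u] becomes arbitrary, afterwards
   [v] is freed too. *)
assert (L : forall v, dom B v -> forall u, inner (S t u) v - inner u (S t v) = 0).
{ intros v Hv u.
  apply (dense_bounded_zero B SB) with
    (L := fun u => inner (S t u) v - inner u (S t v)) (M := 2 * M * norm v).
  - intros a b; rewrite S_minus; inner_expand; ring.
  - intros a; eapply Rle_trans; [apply Bd|]; right; ring.
  - intros a Ha; rewrite S_sym_dom by auto; ring. }
apply Rminus_diag_uniq.
apply (dense_bounded_zero B SB) with
  (L := fun v => inner (S t x) v - inner x (S t v)) (M := 2 * M * norm x).
- intros a b; rewrite S_minus; inner_expand; ring.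
- intros a; eapply Rle_trans; [apply Bd|]; right; ring.
- intros a Ha; apply L; auto.
Qed.

Lemma S'_sym t x y : inner (S' t x) y = inner x (S' t y).
Proof.
assert (D1 := is_derive_inner_l _ t _ y (S_derive _ _ _ _ hS x t)).
assert (D2 := is_derive_inner_l _ t _ x (S_derive _ _ _ _ hS y t)).
apply is_derive_ext with (g := fun r => inner (S r x) y) in D2.
- rewrite (inner_sym _ x), <- (is_derive_unique _ _ _ D1).
  exact (is_derive_unique _ _ _ D2).
- intros r; rewrite S_sym; apply inner_sym.
Qed.

(** Differentiating the symmetry of [S'] in time gives [<A S(t)x, z> = <A S(t)z, x>] for [z] in
    [D(A)]; moving [A] onto [x] and then [S(t)] off [z] leaves [<S(t) A x, z>]. *)
Lemma S_comm t x : dom A x -> A (S t x) = S t (A x).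
Proof.
intros Hx; apply (dense_ext A hA); intros z Hz.
assert (D1 := is_derive_inner_l _ t _ z (S_wave _ _ _ _ hS x t (dom_sqrt x Hx))).
assert (D2 := is_derive_inner_l _ t _ x (S_wave _ _ _ _ hS z t (dom_sqrt z Hz))).
apply is_derive_ext with (g := fun r => inner (S' r x) z) in D2.
- assert (E : inner (opp (A (S t x))) z = inner (opp (A (S t z))) x).
  { rewrite <- (is_derive_unique _ _ _ D1); exact (is_derive_unique _ _ _ D2). }
  revert E; inner_expand; intros E.
  rewrite S_sym, (op_sym A hA x (S t z)), (inner_sym _ x); auto; [lra|].
  apply (S_dom _ _ _ _ hS), dom_sqrt, Hz.
- intros r; rewrite S'_sym; apply inner_sym.
Qed.

End Propagator.

(** * From mild to weak solutions *)

Section Convolution.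
Context {H : HilbertSpace}.

Lemma is_RInt_inner (f : R -> H) a b I z :
  is_RInt f a b I -> is_RInt (fun r => inner (f r) z) a b (inner I z).
Proof.
intros HI.
assert (E : forall ptd, inner (Riemann_sum f ptd) z
  = Riemann_sum (fun r => inner (f r) z) ptd).
{ intros ptd; pattern ptd; apply SF_cons_ind.
  - intros x0; unfold Riemann_sum; simpl; inner_expand; reflexivity.
  - intros h s0 IH; rewrite !Riemann_sum_cons, <- IH; inner_expand; reflexivity. }
unfold is_RInt in *.
apply filterlim_ext with (fun ptd => inner (scal (sign (b - a)) (Riemann_sum f ptd)) z).
- intros ptd; rewrite <- E; inner_expand; reflexivity.
- apply filterlim_inner; [apply _ | exact HI | apply filterlim_const].
Qed.

Lemma continuous_convolution_integrand (f c : R -> H) (t : R) :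
  (forall r, continuous f r) -> (forall r, continuous c r) ->
  forall r, continuous (fun r => inner (f r) (c (t - r))) r.
Proof.
intros Cf Cc r; apply continuous_inner; [apply Cf | apply continuous_opp_arg, Cc].
Qed.

(** Leibniz rule for an integral whose upper limit and integrand both depend on [t]. Pairing with
    [c] makes the integrand real-valued, so the scalar theorem applies although [f] is merely
    continuous. *)
Lemma is_derive_convolution (f c c' : R -> H) t0 t :
  (forall r, continuous f r) -> (forall r, is_derive c r (c' r)) ->
  (forall r, continuous c' r) ->
  is_derive (fun t => RInt (fun r => inner (f r) (c (t - r))) t0 t) t
    (inner (f t) (c 0) + RInt (fun r => inner (f r) (c' (t - r))) t0 t).
Proof.
intros Cf Dc Cc'.
assert (Cc : forall r, continuous c r) by (intros r; exact (is_derive_continuous _ _ _ (Dc r))).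
assert (D : forall r u, is_derive (fun u => inner (f r) (c (u - r))) u (inner (f r) (c' (u - r)))).
{ intros r u.
  apply is_derive_ext with (fun u => inner (c (u - r)) (f r)); [intros; apply inner_sym|].
  rewrite inner_sym; apply is_derive_inner_l, (is_derive_shift c), Dc. }
assert (Ex : forall u a b, ex_RInt (fun r => inner (f r) (c (u - r))) a b).
{ intros u a b; apply (ex_RInt_continuous (V := R_CompleteNormedModule)); intros; now apply continuous_convolution_integrand. }
assert (C2 : forall x y, continuity_2d_pt (fun u v => Derive (fun z => inner (f v) (c (z - v))) u) x y).
{ intros x y; apply continuity_2d_pt_ext with (fun u v => inner (f v) (c' (u - v))).
  - intros u v; symmetry; apply is_derive_unique, D.
  - apply continuity_2d_pt_filterlim.
    apply (filterlim_inner (locally (x, y)) (fun z => f (snd z)) (fun z => c' (fst z - snd z))).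
    + apply (continuous_comp snd f); [apply continuous_snd | apply Cf].
    + apply (continuous_comp (fun z : R * R => fst z - snd z) c'); [|apply Cc'].
      apply (continuous_minus (V := R_NormedModule) fst snd);
        [apply continuous_fst | apply continuous_snd]. }
assert (K := is_derive_RInt_param_bound_comp_aux3 (fun t r => inner (f r) (c (t - r)))
  t0 (fun x => x) t 1).
cbv beta in K.
(* The boundary term takes the shape required by [K]: the integrand at [r = t], with [0] read as
   [t - t], times the derivative [1] of the upper limit. *)
rewrite Rplus_comm, <- (Rmult_1_r (inner (f t) (c 0))), <- (Rminus_diag t).
rewrite (RInt_ext _ (fun r => Derive (fun u => inner (f r) (c (u - r))) t)).
2:{ intros r _; symmetry; apply is_derive_unique, D. }
apply K.
- apply filter_forall; intros u; apply Ex.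
- exists (mkposreal 1 Rlt_0_1); apply filter_forall; intros u; apply Ex.
- exact (is_derive_id t).
- exists (mkposreal 1 Rlt_0_1); apply filter_forall; intros u r _; eexists; apply D.
- intros; apply C2.
- apply locally_2d_forall; intros; apply C2.
- apply continuity_pt_filterlim, (continuous_convolution_integrand f c t); auto.
Qed.

End Convolution.

Lemma continuous_eq_right {V : NormedModule R_AbsRing} (f g : R -> V) t0 :
  continuous f t0 -> continuous g t0 -> (forall t, t0 < t -> f t = g t) -> f t0 = g t0.
Proof.
intros Cf Cg E.
assert (L : filter_le (at_right t0) (locally t0)) by apply filter_le_within.
apply (filterlim_locally_unique (F := at_right t0) f).
- exact (filterlim_filter_le_1 f L Cf).
- apply filterlim_ext_loc with g.
  + exists (mkposreal 1 Rlt_0_1); intros r _ Hr; symmetry; auto.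
  + exact (filterlim_filter_le_1 g L Cg).
Qed.

(** * Duhamel's formula tested against the domain of [A] *)

Section Duhamel.
Context {H : HilbertSpace} (A B : operator H) (S S' : R -> H -> H).
Hypothesis hA : nonneg_self_adjoint A.
Hypothesis hB : is_sqrt_operator A B.
Hypothesis hS : solution_operator A B S S'.
Context (f u du : R -> H) (t0 : R) (u0 u1 : H).
Hypothesis f_cont : forall t, continuous f t.
Hypothesis du_cont : forall t, continuous du t.
Hypothesis u_derive : forall t, t0 < t -> is_derive u t (du t).
Hypothesis duhamel : forall t, t0 <= t -> exists I,
  is_RInt (fun r => S (t - r) (f r)) t0 t I /\
  u t = plus (plus (S' (t - t0) u0) (S (t - t0) u1)) I.

(** Duhamel's formula paired with [z], the propagators moved onto [z] by symmetry, so that time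
    derivatives fall on the orbit of [z] and not on [u]. Both [v] and [v'] make sense for every real
    [t], hence are two-sided differentiable at [t0] when [z] is in [D(A)]. *)
Let v (z : H) t := inner u0 (S' (t - t0) z) + inner u1 (S (t - t0) z)
  + RInt (fun r => inner (f r) (S (t - r) z)) t0 t.
Let v' (z : H) t := - inner u0 (S (t - t0) (A z)) + inner u1 (S' (t - t0) z)
  + RInt (fun r => inner (f r) (S' (t - r) z)) t0 t.

Lemma duhamel_inner z t : t0 <= t -> inner (u t) z = v z t.
Proof.
intros Ht; destruct (duhamel t Ht) as [I [HI E]]; rewrite E; unfold v; inner_expand.
rewrite (S'_sym A B S S' hA hB hS), (S_sym A B S S' hA hB hS); f_equal.
symmetry; apply is_RInt_unique.
apply is_RInt_ext with (fun r => inner (S (t - r) (f r)) z).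
- intros r _; apply (S_sym A B S S' hA hB hS).
- now apply is_RInt_inner.
Qed.

Lemma S_comm_derive z t : dom A z -> is_derive (fun r => S' r z) t (opp (S t (A z))).
Proof.
intros Hz; rewrite <- (S_comm A B S S' hA hB hS t z Hz).
apply (S_wave _ _ _ _ hS), (dom_sqrt A B hB), Hz.
Qed.

Lemma S_continuous z t : continuous (fun r => S r z) t.
Proof. exact (is_derive_continuous _ _ _ (S_derive _ _ _ _ hS z t)). Qed.

Lemma duhamel_derive1 z t : dom A z -> is_derive (v z) t (v' z t).
Proof.
intros Hz.
assert (D1 := is_derive_inner_l _ t _ u0 (is_derive_shift (fun r => S' r z) t0 t _ (S_comm_derive z _ Hz))).
assert (D2 := is_derive_inner_l _ t _ u1 (is_derive_shift (fun r => S r z) t0 t _ (S_derive _ _ _ _ hS z _))).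
assert (D3 := is_derive_convolution f (fun r => S r z) (fun r => S' r z) t0 t f_cont
  (fun r => S_derive _ _ _ _ hS z r) (fun r => S'_continuous _ _ _ _ hS z r)).
assert (D := is_derive_plus _ _ _ _ _ (is_derive_plus _ _ _ _ _ D1 D2) D3).
apply is_derive_ext with (g := v z) in D.
- refine (is_derive_eq _ _ _ _ D _).
  rewrite (S_zero _ _ _ _ hS); inner_expand; unfold v', plus; simpl.
  rewrite !(inner_sym _ u0), (inner_sym _ u1); ring.
- intros r; unfold v, plus; simpl; now rewrite (inner_sym _ u0), (inner_sym _ u1).
Qed.

(** Since [S] commutes with [A], the three terms of the derivative reassemble into [- v (A z) t],
    and the boundary term of the integral is [<f(t), z>] because [S'(0) = I]. *)
Lemma duhamel_derive2 z t : dom A z ->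
  is_derive (v' z) t (inner (f t) z - v (A z) t).
Proof.
intros Hz.
assert (D1 := is_derive_opp _ _ _ (is_derive_inner_l _ t _ u0
  (is_derive_shift (fun r => S r (A z)) t0 t _ (S_derive _ _ _ _ hS (A z) _)))).
assert (D2 := is_derive_inner_l _ t _ u1 (is_derive_shift (fun r => S' r z) t0 t _ (S_comm_derive z _ Hz))).
assert (D3 := is_derive_convolution f (fun r => S' r z) (fun r => opp (S r (A z))) t0 t f_cont
  (fun r => S_comm_derive z r Hz) (fun r => continuous_opp _ _ (S_continuous (A z) r))).
assert (D := is_derive_plus _ _ _ _ _ (is_derive_plus _ _ _ _ _ D1 D2) D3).
apply is_derive_ext with (g := v' z) in D.
- refine (is_derive_eq _ _ _ _ D _).
  rewrite (RInt_ext _ (fun r => opp (inner (f r) (S (t - r) (A z)))))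
    by (intros; inner_expand; reflexivity).
  rewrite (RInt_opp (V := R_CompleteNormedModule)).
  2:{ apply (ex_RInt_continuous (V := R_CompleteNormedModule)); intros r _.
      apply (continuous_convolution_integrand f (fun r => S r (A z)) t f_cont (S_continuous (A z))). }
  inner_expand; unfold v, plus, opp; simpl; rewrite (S'_zero _ _ _ _ hS).
  rewrite !(inner_sym _ u0), (inner_sym _ u1); ring.
- intros r; unfold v', plus, opp; simpl; now rewrite (inner_sym _ u0), (inner_sym _ u1).
Qed.

Lemma duhamel_inner_derivative z t : dom A z -> t0 < t -> inner (du t) z = v' z t.
Proof.
intros Hz Ht.
assert (D1 := is_derive_inner_l _ t _ z (u_derive t Ht)).
assert (D2 := duhamel_derive1 z t Hz).
apply is_derive_ext_loc with (g := fun r => inner (u r) z) in D2.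
- rewrite <- (is_derive_unique _ _ _ D1); exact (is_derive_unique _ _ _ D2).
- apply filter_imp with (fun r => t0 < r); [|exact (open_gt t0 t Ht)].
  intros r Hr; symmetry; apply duhamel_inner; lra.
Qed.

Lemma duhamel_weak z t : dom A z -> t0 < t ->
  is_derive (fun r => inner (du r) z) t (inner (f t) z - inner (u t) (A z)).
Proof.
intros Hz Ht; rewrite (duhamel_inner (A z) t) by lra.
apply is_derive_ext_loc with (v' z).
- apply filter_imp with (fun r => t0 < r); [|exact (open_gt t0 t Ht)].
  intros r Hr; symmetry; now apply duhamel_inner_derivative.
- now apply duhamel_derive2.
Qed.

Lemma duhamel_initial_position : u t0 = u0.
Proof.
apply inner_ext; intros z; rewrite duhamel_inner by lra; unfold v.
rewrite Rminus_diag, RInt_point, (S_zero _ _ _ _ hS), (S'_zero _ _ _ _ hS).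
inner_expand; unfold zero; simpl; ring.
Qed.

(** The velocity is identified with [v'] only for [t > t0]; continuity of both from the right
    carries the equality to [t0]. *)
Lemma duhamel_initial_velocity : du t0 = u1.
Proof.
apply (dense_ext A hA); intros z Hz.
rewrite (continuous_eq_right (V := R_NormedModule) (fun t => inner (du t) z) (v' z) t0).
- unfold v'; rewrite Rminus_diag, RInt_point, (S_zero _ _ _ _ hS), (S'_zero _ _ _ _ hS).
  inner_expand; unfold zero; simpl; ring.
- apply continuous_inner; [apply du_cont | apply continuous_const].
- exact (is_derive_continuous (V := R_NormedModule) _ _ _ (duhamel_derive2 z t0 Hz)).
- intros t Ht; now apply duhamel_inner_derivative.
Qed.

End Duhamel.

(** * Energy identities for weak solutions of the forced wave equation *)

(** The mean value theorem bounds [N k r - N k t - (r - t) l] by [e |r - t|] for all small [k] at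
    once, and the bound survives [k -> 0]. Convergence of [d] along the product filter supplies the
    uniformity in [r]. *)
Lemma derive_of_limit (N d : R -> R -> R) (N0 : R -> R) t l :
  locally t (fun r => forall k, 0 < k -> is_derive (N k) r (d k r)) ->
  locally t (fun r => filterlim (fun k => N k r) (at_right 0) (locally (N0 r))) ->
  filterlim (fun p => d (fst p) (snd p)) (filter_prod (at_right 0) (locally t)) (locally l) ->
  is_derive N0 t l.
Proof.
intros HN HL Hd; apply is_derive_remainder; intros e He.
destruct (proj1 (filterlim_locally _ _) Hd (mkposreal e He)) as [Q1 Q2 HQ1 HQ2 HQ].
destruct (filter_and _ _ HQ2 (filter_and _ _ HN HL)) as [del Hdel].
exists del; intros r Hr.
assert (Lim : filterlim (fun k => N k r - N k t - (r - t) * l) (at_right 0)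
  (locally (N0 r - N0 t - (r - t) * l))).
{ assert (L1 := proj2 (proj2 (Hdel r Hr))).
  assert (L2 := proj2 (proj2 (Hdel t (ball_center t del)))).
  assert (L3 := filterlim_comp _ _ _ _ _ _ _ _ L2 (filterlim_opp (N0 t))).
  assert (L4 := filterlim_comp_2 _ _ _ L1 L3 (filterlim_plus _ _)).
  exact (filterlim_comp_2 _ _ _ L4 (filterlim_const (- ((r - t) * l))) (filterlim_plus _ _)). }
assert (Bd : at_right 0 (fun k => Rabs (N k r - N k t - (r - t) * l) <= e * Rabs (r - t))).
{ assert (Pos : at_right 0 (fun k => 0 < k)) by (exists (mkposreal 1 Rlt_0_1); auto).
  generalize (filter_and _ _ HQ1 Pos); apply filter_imp; intros k [Hk Pk].
  assert (In : forall x, Rmin t r <= x <= Rmax t r -> ball t del x).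
  { intros x Hx; revert Hr; unfold ball; simpl; unfold AbsRing_ball, abs, minus, plus, opp; simpl.
    intros Hr; apply Rabs_def2 in Hr; apply Rabs_def1;
      revert Hx; unfold Rmin, Rmax; destruct (Rle_dec t r); lra. }
  destruct (MVT_gen (N k) t r (d k)) as [c [Hc E]].
  - intros x Hx; apply (Hdel x); [apply In; lra | auto].
  - intros x Hx; apply continuity_pt_filterlim.
    exact (is_derive_continuous (V := R_NormedModule) _ _ _ (proj1 (proj2 (Hdel x (In x Hx))) k Pk)).
  - rewrite E; replace (d k c * (r - t) - (r - t) * l) with ((d k c - l) * (r - t)) by ring.
    rewrite Rabs_mult; apply Rmult_le_compat_r; [apply Rabs_pos|].
    apply Rlt_le; exact (HQ k c Hk (proj1 (Hdel c (In c Hc)))). }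
exact (filterlim_le (F := at_right 0) _ _ (Finite _) (Finite _) Bd
  (filterlim_comp _ _ _ _ _ _ _ _ Lim (filterlim_norm _)) (filterlim_const _)).
Qed.

(** * Difference quotients and time averages *)

Section DifferenceQuotient.
Context {H : HilbertSpace}.

(** For a primitive [z] of [x] this is the average of [x] over [[r, r + k]]; for [z = x] it is the
    time derivative of that average. *)
Definition dquot (z : R -> H) (k r : R) : H := scal (/ k) (minus (z (r + k)) (z r)).

Lemma is_derive_dquot (z z' : R -> H) k r :
  is_derive z r (z' r) -> is_derive z (r + k) (z' (r + k)) ->
  is_derive (dquot z k) r (dquot z' k r).
Proof.
intros D1 D2.
replace (r + k) with (r - - k) in D2 by ring.
assert (D3 := is_derive_shift z (- k) r _ D2).
replace (r - - k) with (r + k) in D3 by ring.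
apply is_derive_ext with (g := fun q => z (q + k)) in D3.
2:{ intros q; f_equal; ring. }
assert (D4 := filterdiff_scal_r_fct (/ k) _ _ Rmult_comm
  (is_derive_minus (V := H) _ _ _ _ _ D3 D1)).
apply filterdiff_ext_lin with (1 := D4); intros q; unfold dquot.
rewrite !scal_assoc; f_equal; apply Rmult_comm.
Qed.

Lemma filterlim_dquot (z z' : R -> H) t :
  locally t (fun r => is_derive z r (z' r)) -> continuous z' t ->
  filterlim (fun p => dquot z (fst p) (snd p)) (filter_prod (at_right 0) (locally t))
    (locally (z' t)).
Proof.
intros D C; refine (proj2 (filterlim_locally_ball_norm (U := H) _ _) _); intros eps.
assert (He : 0 < eps / 2) by (assert (K := cond_pos eps); lra).
destruct (filter_and _ _ D (proj1 (filterlim_locally_ball_norm _ _) C (mkposreal _ He))) as [del Hdel].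
assert (Hd : 0 < del / 2) by (assert (K := cond_pos del); lra).
apply Filter_prod with (fun k => 0 < k < del / 2) (fun r => Rabs (r - t) < del / 2).
- exists (mkposreal _ Hd); intros k Hk Pk; split; auto.
  revert Hk; unfold ball; simpl; unfold AbsRing_ball, abs, minus, plus, opp; simpl.
  intros Hk; apply Rabs_def2 in Hk; lra.
- exists (mkposreal _ Hd); intros r Hr; exact Hr.
- intros k r [Pk Lk] Hr; unfold ball_norm; simpl.
  (* Pairing with the remainder [w] itself reduces the vector case to the scalar mean value theorem:
     [|w|^2 = k <z'(c) - z'(t), w>], and one factor [|w|] cancels. *)
  set (w := minus (minus (z (r + k)) (z r)) (scal k (z' t))).
  replace (minus _ _) with (scal (/ k) w).
  2:{ unfold dquot, w; vec; field; lra. }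
  assert (In : forall x, r <= x <= r + k -> ball t del x).
  { intros x Hx; unfold ball; simpl; unfold AbsRing_ball, abs, minus, plus, opp; simpl.
    apply Rabs_def2 in Hr; apply Rabs_def1; lra. }
  destruct (MVT_gen (fun x => inner (z x) w) r (r + k) (fun x => inner (z' x) w)) as [c [Hc E]].
  + intros x; rewrite Rmin_left, Rmax_right by lra; intros Hx.
    apply is_derive_inner_l, Hdel, In; lra.
  + intros x; rewrite Rmin_left, Rmax_right by lra; intros Hx.
    apply continuity_pt_filterlim.
    refine (is_derive_continuous (V := R_NormedModule) _ _ (inner (z' x) w) _).
    apply is_derive_inner_l, Hdel, In; lra.
  + rewrite Rmin_left, Rmax_right in Hc by lra.
    assert (Ew : norm w ^ 2 = k * inner (minus (z' c) (z' t)) w).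
    { rewrite norm_sq; unfold w at 1; inner_expand; lra. }
    assert (Nc := proj2 (Hdel c (In c Hc))); unfold ball_norm in Nc; simpl in Nc.
    assert (CS := Cauchy_Schwarz (minus (z' c) (z' t)) w).
    assert (Nw := norm_ge_0 w).
    assert (Le := Rle_abs (inner (minus (z' c) (z' t)) w)).
    assert (Ineq : inner (minus (z' c) (z' t)) w <= eps / 2 * norm w).
    { eapply Rle_trans; [exact Le|]; eapply Rle_trans; [exact CS|].
      apply Rmult_le_compat_r; [exact Nw | apply Rlt_le; exact Nc]. }
    rewrite norm_scal_abs, Rabs_pos_eq by (apply Rlt_le, Rinv_0_lt_compat; lra).
    apply Rmult_lt_reg_l with k; auto.
    rewrite <- Rmult_assoc, Rinv_r, Rmult_1_l by lra.
    assert (Ke := cond_pos eps).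
    destruct (Req_dec (norm w) 0) as [Z|Z]; [rewrite Z; nra|].
    assert (norm w <= k * (eps / 2)); [|nra].
    apply Rmult_le_reg_r with (norm w); [lra|].
    replace (norm w * norm w) with (norm w ^ 2) by ring.
    rewrite Ew, Rmult_assoc; apply Rmult_le_compat_l; [lra | exact Ineq].
Qed.

Lemma filterlim_dquot_at (z z' : R -> H) t :
  locally t (fun r => is_derive z r (z' r)) -> continuous z' t ->
  filterlim (fun k => dquot z k t) (at_right 0) (locally (z' t)).
Proof.
intros D C.
apply (filterlim_comp _ _ _ (fun k => (k, t)) (fun p => dquot z (fst p) (snd p))
  (at_right 0) (filter_prod (at_right 0) (locally t))).
- apply filterlim_pair; [apply filterlim_id|].
  intros P HP; change (at_right 0 (fun _ => P t)).
  apply filter_forall; intros k; exact (locally_singleton _ _ HP).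
- now apply filterlim_dquot.
Qed.

Lemma is_derive_primitive (f : R -> H) t :
  (forall r, continuous f r) -> is_derive (RInt f 0) t (f t).
Proof.
intros C; apply (is_derive_RInt f (RInt f 0) 0 t); auto.
apply filter_forall; intros b; apply (RInt_correct (V := H)), (ex_RInt_continuous (V := H)); auto.
Qed.

End DifferenceQuotient.

(* The time averages [k^-1 int_t^(t+k) x] of a weak solution take values in
   the domain of [A], so both identities hold for them by differentiation; the
   case of [x] itself is the limit [k -> 0]. *)
Section WeakWave.
Context {H : HilbertSpace} (A B : operator H).
Hypothesis hA : nonneg_self_adjoint A.
Hypothesis hB : is_sqrt_operator A B.
Context (x y g : R -> H) (t0 : R).
Hypothesis x_dom : forall t, dom B (x t).
Hypothesis x_cont : forall t, continuous x t.
Hypothesis Bx_cont : forall t, continuous (fun r => B (x r)) t.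
Hypothesis y_cont : forall t, continuous y t.
Hypothesis g_cont : forall t, continuous g t.
Hypothesis x_derive : forall t, t0 < t -> is_derive x t (y t).
Hypothesis weak : forall z t, dom A z -> t0 < t ->
  is_derive (fun r => inner (y r) z) t (inner (g t) z - inner (x t) (A z)).

Let X := RInt x 0.
Let BX := RInt (fun r => B (x r)) 0.
Let G := RInt g 0.

(** A closed operator passes through an integral. Closedness is used in adjoint form: for each [z]
    in the domain, [<X, B z> - <BX, z>] has zero derivative, so the increments of [X] and [BX] form
    a pair in the graph of the adjoint of [B], which is [B]. *)
Lemma primitive_sqrt a b :
  dom B (minus (X b) (X a)) /\ B (minus (X b) (X a)) = minus (BX b) (BX a).
Proof.
destruct (proj1 hB) as [_ [SA _]].
apply (SA (minus (X b) (X a)) (minus (BX b) (BX a))); intros z Hz.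
assert (D : forall r, is_derive (fun r => minus (inner (X r) (B z)) (inner (BX r) z)) r zero).
{ intros r.
  assert (D1 := is_derive_inner_l _ r _ (B z) (is_derive_primitive x r x_cont)).
  assert (D2 := is_derive_inner_l _ r _ z (is_derive_primitive _ r Bx_cont)).
  refine (is_derive_eq _ _ _ _ (is_derive_minus _ _ _ _ _ D1 D2) _).
  rewrite (op_sym B (proj1 hB) (x r) z) by auto; apply (minus_eq_zero (G := R_AbelianGroup)). }
assert (E := constant_of_derive_zero _ D a b); cbv beta in E.
revert E; unfold minus, plus, opp at 1 2 3 4; simpl; intros E.
change (inner (B z) (minus (X b) (X a)) = inner z (minus (BX b) (BX a))).
inner_expand; rewrite !(inner_sym _ (B z)), !(inner_sym _ z); lra.
Qed.

(** Integrating the weak equation over [[a, b]] represents [z |-> <A z, X(b) - X(a)>] by a fixed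
    vector; self-adjointness turns this into membership in [D(A)], a gain of regularity over [x]. *)
Lemma primitive_dom a b : t0 < a -> a < b ->
  dom A (minus (X b) (X a)) /\
  A (minus (X b) (X a)) = minus (minus (G b) (G a)) (minus (y b) (y a)).
Proof.
intros Ha Hab; destruct hA as [_ [SA _]].
apply SA; intros z Hz.
assert (D : forall r, a <= r <= b -> is_derive
  (fun r => plus (minus (inner (X r) (A z)) (inner (G r) z)) (inner (y r) z)) r zero).
{ intros r Hr.
  assert (D1 := is_derive_inner_l _ r _ (A z) (is_derive_primitive x r x_cont)).
  assert (D2 := is_derive_inner_l _ r _ z (is_derive_primitive g r g_cont)).
  assert (D3 := weak z r Hz ltac:(lra)).
  refine (is_derive_eq _ _ _ _ (is_derive_plus _ _ _ _ _ (is_derive_minus _ _ _ _ _ D1 D2) D3) _).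
  unfold zero, minus, plus, opp; simpl; ring. }
assert (E := eq_is_derive _ a b D Hab); cbv beta in E.
revert E; unfold minus, plus, opp at 1 2 3 4; simpl; intros E.
change (inner (A z) (minus (X b) (X a)) = inner z (minus (minus (G b) (G a)) (minus (y b) (y a)))).
inner_expand; rewrite !(inner_sym _ (A z)), !(inner_sym _ z); lra.
Qed.

Lemma dquot_sqrt k r : dom B (dquot X k r) /\ B (dquot X k r) = dquot BX k r.
Proof.
destruct (primitive_sqrt r (r + k)) as [D E]; unfold dquot.
split; [now apply dom_scal | now rewrite op_scal, E].
Qed.

Lemma dquot_dom k r : 0 < k -> t0 < r ->
  dom A (dquot X k r) /\ A (dquot X k r) = minus (dquot G k r) (dquot y k r).
Proof.
intros Hk Hr; destruct (primitive_dom r (r + k) Hr ltac:(lra)) as [D E]; unfold dquot.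
split; [now apply dom_scal | rewrite op_scal, E by auto; vec].
Qed.

Lemma dquot_x k r : dom B (dquot x k r) /\ B (dquot x k r) = dquot (fun r => B (x r)) k r.
Proof.
unfold dquot; assert (D : dom B (minus (x (r + k)) (x r))) by now apply dom_minus.
split; [now apply dom_scal | now rewrite op_scal, op_minus].
Qed.

Lemma locally_after t (P : R -> Prop) : t0 < t -> (forall r, t0 < r -> P r) -> locally t P.
Proof.
intros Ht HP; apply filter_imp with (fun r => t0 < r); [auto | exact (open_gt t0 t Ht)].
Qed.

Lemma wave_energy t : t0 < t ->
  is_derive (fun r => inner (y r) (y r) + inner (B (x r)) (B (x r))) t
    (2 * inner (y t) (g t)).
Proof.
intros Ht.
assert (Lx : forall r, t0 < r -> locally r (fun q => is_derive x q (y q)))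
  by (intros; apply locally_after; auto).
assert (LB : forall r, locally r (fun q => is_derive BX q (B (x q))))
  by (intros; apply filter_forall; intros; now apply (is_derive_primitive (fun r => B (x r)))).
assert (LG : forall r, locally r (fun q => is_derive G q (g q)))
  by (intros; apply filter_forall; intros; now apply is_derive_primitive).
(* [N k] is the energy of the averaged solution [dquot X k], whose velocity is [dquot x k] and whose
   forcing is [dquot G k]. *)
apply derive_of_limit with
  (N := fun k r => inner (dquot x k r) (dquot x k r) + inner (dquot BX k r) (dquot BX k r))
  (d := fun k r => 2 * inner (dquot x k r) (dquot G k r)).
- apply locally_after; auto; intros r Hr k Hk.
  assert (D1 : is_derive (dquot x k) r (dquot y k r)) by (apply is_derive_dquot; apply x_derive; lra).
  assert (D2 : is_derive (dquot BX k) r (dquot (fun r => B (x r)) k r))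
    by (apply (is_derive_dquot BX (fun r => B (x r))); now apply (is_derive_primitive (fun r => B (x r)))).
  refine (is_derive_eq _ _ _ _ (is_derive_plus _ _ _ _ _
    (is_derive_inner _ _ _ _ _ D1 D1) (is_derive_inner _ _ _ _ _ D2 D2)) _).
  unfold plus; simpl.
  destruct (dquot_x k r) as [Dx Ex]; destruct (dquot_sqrt k r) as [DX EX].
  destruct (dquot_dom k r Hk Hr) as [DA EA].
  assert (F := sqrt_form A B hB _ _ DA Dx); rewrite EA, EX, Ex in F; revert F; inner_expand; intros F.
  rewrite (inner_sym _ _ (dquot BX k r)), (inner_sym _ (dquot y k r)), (inner_sym _ (dquot x k r) (dquot G k r)).
  rewrite (inner_sym _ (dquot y k r)) in F; lra.
- apply locally_after; auto; intros r Hr.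
  assert (L1 := filterlim_dquot_at x y r (Lx r Hr) (y_cont r)).
  assert (L2 := filterlim_dquot_at BX _ r (LB r) (Bx_cont r)).
  exact (filterlim_comp_2 _ _ _ (filterlim_inner _ _ _ _ _ L1 L1)
    (filterlim_inner _ _ _ _ _ L2 L2) (filterlim_plus _ _)).
- assert (L1 := filterlim_dquot x y t (Lx t Ht) (y_cont t)).
  assert (L2 := filterlim_dquot G g t (LG t) (g_cont t)).
  exact (filterlim_comp _ _ _ _ _ _ _ _ (filterlim_inner _ _ _ _ _ L1 L2) (filterlim_scal_r 2 _)).
Qed.

Lemma wave_virial t : t0 < t ->
  is_derive (fun r => inner (y r) (x r)) t
    (inner (y t) (y t) - inner (B (x t)) (B (x t)) + inner (g t) (x t)).
Proof.
intros Ht.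
assert (Lx : forall r, t0 < r -> locally r (fun q => is_derive x q (y q)))
  by (intros; apply locally_after; auto).
assert (LX : forall r, locally r (fun q => is_derive X q (x q)))
  by (intros; apply filter_forall; intros; now apply is_derive_primitive).
assert (LB : forall r, locally r (fun q => is_derive BX q (B (x q))))
  by (intros; apply filter_forall; intros; now apply (is_derive_primitive (fun r => B (x r)))).
assert (LG : forall r, locally r (fun q => is_derive G q (g q)))
  by (intros; apply filter_forall; intros; now apply is_derive_primitive).
(* Velocity times position for the averaged solution [dquot X k]. *)
apply derive_of_limit with
  (N := fun k r => inner (dquot x k r) (dquot X k r))
  (d := fun k r => inner (dquot x k r) (dquot x k r)
     - inner (dquot BX k r) (dquot BX k r) + inner (dquot G k r) (dquot X k r)).
- apply locally_after; auto; intros r Hr k Hk.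
  assert (D1 : is_derive (dquot x k) r (dquot y k r)) by (apply is_derive_dquot; apply x_derive; lra).
  assert (D2 : is_derive (dquot X k) r (dquot x k r))
    by (apply is_derive_dquot; now apply is_derive_primitive).
  refine (is_derive_eq _ _ _ _ (is_derive_inner _ _ _ _ _ D1 D2) _).
  destruct (dquot_sqrt k r) as [DX EX].
  destruct (dquot_dom k r Hk Hr) as [DA EA].
  assert (F := sqrt_form A B hB _ _ DA DX); rewrite EA, EX in F; revert F; inner_expand; lra.
- apply locally_after; auto; intros r Hr.
  exact (filterlim_inner _ _ _ _ _ (filterlim_dquot_at x y r (Lx r Hr) (y_cont r))
    (filterlim_dquot_at X x r (LX r) (x_cont r))).
- assert (L1 := filterlim_dquot x y t (Lx t Ht) (y_cont t)).
  assert (L2 := filterlim_dquot G g t (LG t) (g_cont t)).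
  assert (L3 := filterlim_dquot X x t (LX t) (x_cont t)).
  assert (L4 := filterlim_dquot BX _ t (LB t) (Bx_cont t)).
  assert (M := filterlim_comp _ _ _ _ _ _ _ _ (filterlim_inner _ _ _ _ _ L4 L4) (filterlim_opp _)).
  exact (filterlim_comp_2 _ _ _ (filterlim_comp_2 _ _ _ (filterlim_inner _ _ _ _ _ L1 L1) M
    (filterlim_plus _ _)) (filterlim_inner _ _ _ _ _ L2 L3) (filterlim_plus _ _)).
Qed.

End WeakWave.

(** * The potential along a trajectory *)

Section Potential.
Context {H : HilbertSpace} (B : operator H) (F : H -> R) (gradF : H -> H).
Hypothesis F_diff : F_differentiable B F gradF.
Hypothesis F_lip : F_locally_lipschitz B gradF.

Lemma norm1_ge_0 v : 0 <= norm1 B v.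
Proof. apply sqrt_pos. Qed.

Lemma norm1_le_sum v : norm1 B v <= norm v + norm (B v).
Proof.
assert (K1 := norm_ge_0 v); assert (K2 := norm_ge_0 (B v)).
rewrite <- (sqrt_Rsqr (norm v + norm (B v))) by lra.
apply sqrt_le_1_alt; unfold Rsqr; nra.
Qed.

Lemma norm1_scal a v : dom B v -> norm1 B (scal a v) = Rabs a * norm1 B v.
Proof.
intros Hv; unfold norm1; rewrite op_scal, !norm_scal_abs by auto.
rewrite <- (sqrt_Rsqr (Rabs a)) at 3 by apply Rabs_pos.
rewrite <- sqrt_mult_alt by apply Rle_0_sqr; f_equal; unfold Rsqr; ring.
Qed.

Lemma gradF_continuous_at w e : dom B w -> 0 < e -> exists d, 0 < d /\
  forall v, dom B v -> norm (minus v w) < d -> norm (minus (B v) (B w)) < d ->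
    norm (minus (gradF v) (gradF w)) < e.
Proof.
intros Hw He; destruct F_lip as [L0 [_ [Bd Lip]]].
(* The [2] leaves room for [v] and [B v] to move by at most [1] each, so one Lipschitz constant
   serves for all such [v]. *)
destruct (Bd (norm w + norm (B w) + 2)) as [M HM].
assert (PM : 0 < Rabs M + 1) by (assert (K := Rabs_pos M); lra).
assert (Pd : 0 < e / (2 * (Rabs M + 1))) by (apply Rdiv_lt_0_compat; lra).
exists (Rmin 1 (e / (2 * (Rabs M + 1)))); split; [apply Rmin_glb_lt; lra|].
intros v Hv D1 D2.
assert (m1 := Rmin_l 1 (e / (2 * (Rabs M + 1)))); assert (m2 := Rmin_r 1 (e / (2 * (Rabs M + 1)))).
assert (N : norm1 B (minus v w) < 2 * (e / (2 * (Rabs M + 1)))).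
{ eapply Rle_lt_trans; [apply norm1_le_sum|]; rewrite op_minus by auto; lra. }
assert (Tri : forall a b : H, norm (minus a b) < 1 -> norm a <= norm b + 1).
{ intros a b Hab; replace a with (plus b (minus a b)) by vec.
  eapply Rle_trans; [apply norm_plus_le|]; apply Rplus_le_compat_l, Rlt_le; exact Hab. }
assert (N1 : norm1 B v <= norm w + norm (B w) + 2).
{ eapply Rle_trans; [apply norm1_le_sum|].
  assert (T1 := Tri v w ltac:(lra)); assert (T2 := Tri (B v) (B w) ltac:(lra)); lra. }
assert (N2 := norm1_le_sum w); assert (P1 := norm1_ge_0 v); assert (P2 := norm1_ge_0 w).
assert (LM := HM (norm1 B v) (norm1 B w) ltac:(lra) ltac:(lra)).
eapply Rle_lt_trans; [apply Lip; auto|].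
assert (AM := Rle_abs M); assert (P3 := norm1_ge_0 (minus v w)).
apply Rle_lt_trans with ((Rabs M + 1) * norm1 B (minus v w)).
- apply Rmult_le_compat_r; lra.
- apply Rlt_le_trans with ((Rabs M + 1) * (2 * (e / (2 * (Rabs M + 1))))).
  + apply Rmult_lt_compat_l; lra.
  + right; field; lra.
Qed.

Lemma F_derive_segment u h r : dom B u -> dom B h ->
  is_derive (fun q => F (plus u (scal q h))) r (inner (gradF (plus u (scal r h))) h).
Proof.
intros Hu Hh; apply is_derive_remainder; intros e He.
assert (Hr : forall q, dom B (plus u (scal q h))) by (intros; apply dom_plus; auto using dom_scal).
assert (Nh := norm1_ge_0 h).
assert (He' : 0 < e / (norm1 B h + 1)) by (apply Rdiv_lt_0_compat; lra).
destruct F_diff as [_ [_ D]]; destruct (D _ (Hr r) _ He') as [d [Hd Hd']].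
assert (Hrad : 0 < d / (norm1 B h + 1)) by (apply Rdiv_lt_0_compat; lra).
exists (mkposreal _ Hrad); intros q Hq.
change (Rabs (q - r) < d / (norm1 B h + 1)) in Hq.
assert (Aq := Rabs_pos (q - r)).
specialize (Hd' (scal (q - r) h) (dom_scal _ _ _ _ Hh)); rewrite norm1_scal in Hd' by auto.
replace (plus (plus u (scal r h)) (scal (q - r) h)) with (plus u (scal q h)) in Hd' by vec.
assert (Sm : Rabs (q - r) * norm1 B h < d).
{ apply Rle_lt_trans with (Rabs (q - r) * (norm1 B h + 1)); [nra|].
  apply Rmult_lt_compat_r with (r := norm1 B h + 1) in Hq; [|lra].
  replace (d / (norm1 B h + 1) * (norm1 B h + 1)) with d in Hq by (field; lra); exact Hq. }
specialize (Hd' Sm); revert Hd'; inner_expand; intros Hd'.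
apply Rle_trans with (e / (norm1 B h + 1) * (Rabs (q - r) * norm1 B h)); [exact Hd'|].
replace (e / (norm1 B h + 1) * (Rabs (q - r) * norm1 B h))
  with (e * Rabs (q - r) * (norm1 B h / (norm1 B h + 1))) by (field; lra).
rewrite <- (Rmult_1_r (e * Rabs (q - r))) at 2.
apply Rmult_le_compat_l; [nra|].
apply Rmult_le_reg_r with (norm1 B h + 1); [lra|].
replace (norm1 B h / (norm1 B h + 1) * (norm1 B h + 1)) with (norm1 B h) by (field; lra); lra.
Qed.

Lemma F_mean_value u v : dom B u -> dom B v -> exists q, 0 <= q <= 1 /\
  F v - F u = inner (gradF (plus u (scal q (minus v u)))) (minus v u).
Proof.
intros Hu Hv; assert (Hh : dom B (minus v u)) by now apply dom_minus.
destruct (MVT_gen (fun q => F (plus u (scal q (minus v u)))) 0 1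
  (fun q => inner (gradF (plus u (scal q (minus v u)))) (minus v u))) as [q [Hq E]].
- intros x _; now apply F_derive_segment.
- intros x _; apply continuity_pt_filterlim.
  exact (is_derive_continuous (V := R_NormedModule) _ _ _ (F_derive_segment u (minus v u) x Hu Hh)).
- rewrite Rmin_left, Rmax_right in Hq by lra; exists q; split; auto.
  replace (plus u (scal 1 (minus v u))) with v in E by vec.
  replace (plus u (scal 0 (minus v u))) with u in E by vec.
  rewrite E; ring.
Qed.

Section Trajectory.
Context (x : R -> H) (t : R).
Hypothesis x_dom : forall r, dom B (x r).
Hypothesis x_cont : continuous x t.
Hypothesis Bx_cont : continuous (fun r => B (x r)) t.

(** The [H_1] differentiability of [F] cannot be composed directly with a curve differentiable only
    in [H]. As the gradient is [H]-valued and continuous for the [H_1] norm, the increment of [F] is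
    instead an exact pairing in [H] with a vector close to the gradient; differentiability of the
    curve in [H] then suffices. *)
Lemma F_mean_value_near e : 0 < e -> locally t (fun r => exists w,
  norm (minus w (gradF (x t))) < e /\ F (x r) - F (x t) = inner w (minus (x r) (x t))).
Proof.
intros He; destruct (gradF_continuous_at (x t) e (x_dom t) He) as [d [Hd Hd']].
generalize (filter_and _ _
  (proj1 (filterlim_locally_ball_norm _ _) x_cont (mkposreal d Hd))
  (proj1 (filterlim_locally_ball_norm _ _) Bx_cont (mkposreal d Hd))).
apply filter_imp; intros r [N1 N2].
destruct (F_mean_value (x t) (x r) (x_dom t) (x_dom r)) as [q [Hq E]].
exists (gradF (plus (x t) (scal q (minus (x r) (x t))))); split; auto.
assert (D : dom B (minus (x r) (x t))) by now apply dom_minus.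
assert (Le : forall a : H, norm a < d -> norm (scal q a) < d).
{ intros a Ha; rewrite norm_scal_abs, Rabs_pos_eq by lra; assert (K := norm_ge_0 a).
  apply Rle_lt_trans with (norm a); [|exact Ha].
  rewrite <- (Rmult_1_l (norm a)) at 2; apply Rmult_le_compat_r; [exact K | lra]. }
apply Hd'.
- apply dom_plus; auto using dom_scal.
- replace (minus _ (x t)) with (scal q (minus (x r) (x t))) by vec; apply Le, N1.
- rewrite op_plus, op_scal, op_minus by auto using dom_scal.
  replace (minus _ (B (x t))) with (scal q (minus (B (x r)) (B (x t)))) by vec; apply Le, N2.
Qed.

Lemma continuous_gradF : continuous (fun r => gradF (x r)) t.
Proof.
refine (proj2 (filterlim_locally_ball_norm (U := H) _ _) _); intros e.
destruct (gradF_continuous_at (x t) e (x_dom t) (cond_pos e)) as [d [Hd Hd']].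
generalize (filter_and _ _
  (proj1 (filterlim_locally_ball_norm _ _) x_cont (mkposreal d Hd))
  (proj1 (filterlim_locally_ball_norm _ _) Bx_cont (mkposreal d Hd))).
apply filter_imp; intros r [N1 N2]; apply Hd'; auto.
Qed.

Lemma continuous_F : continuous (fun r => F (x r)) t.
Proof.
refine (proj2 (filterlim_locally_ball_norm (U := R_NormedModule) _ _) _); intros e.
set (M := norm (gradF (x t)) + 1).
assert (PM : 0 < M) by (assert (K := norm_ge_0 (gradF (x t))); unfold M; lra).
assert (Pe : 0 < e / M) by (apply Rdiv_lt_0_compat; [apply cond_pos | lra]).
generalize (filter_and _ _ (F_mean_value_near 1 Rlt_0_1)
  (proj1 (filterlim_locally_ball_norm _ _) x_cont (mkposreal _ Pe))).
apply filter_imp; intros r [[w [Hw E]] N].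
change (Rabs (F (x r) - F (x t)) < e); rewrite E.
assert (Nw : norm w <= M).
{ replace w with (plus (gradF (x t)) (minus w (gradF (x t)))) by vec.
  eapply Rle_trans; [apply norm_plus_le|]; unfold M; apply Rplus_le_compat_l, Rlt_le; exact Hw. }
eapply Rle_lt_trans; [apply Cauchy_Schwarz|].
apply Rle_lt_trans with (M * norm (minus (x r) (x t))).
- apply Rmult_le_compat_r; [apply norm_ge_0 | auto].
- apply Rlt_le_trans with (M * (e / M)); [|right; field; lra].
  apply Rmult_lt_compat_l; [auto | exact N].
Qed.

Lemma is_derive_F y : is_derive x t y ->
  is_derive (fun r => F (x r)) t (inner (gradF (x t)) y).
Proof.
intros D; apply is_derive_remainder; intros e He.
assert (P1 := norm_ge_0 y); assert (P2 := norm_ge_0 (gradF (x t))).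
assert (E1 : 0 < e / (2 * (norm y + 1))) by (apply Rdiv_lt_0_compat; lra).
assert (E2 : 0 < e / (2 * (norm (gradF (x t)) + 1))) by (apply Rdiv_lt_0_compat; lra).
generalize (filter_and _ _ (F_mean_value_near _ E1) (filter_and _ _
  (proj1 (is_derive_remainder _ _ _) D 1 Rlt_0_1)
  (proj1 (is_derive_remainder _ _ _) D _ E2))).
apply filter_imp; intros r [[w [Hw E]] [N1 N2]].
assert (Pr := Rabs_pos (r - t)).
set (rem := minus (minus (x r) (x t)) (scal (r - t) y)) in *.
assert (Nx : norm (minus (x r) (x t)) <= (norm y + 1) * Rabs (r - t)).
{ replace (minus (x r) (x t)) with (plus (scal (r - t) y) rem) by (unfold rem; vec).
  eapply Rle_trans; [apply norm_plus_le|].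
  apply Rle_trans with (Rabs (r - t) * norm y + 1 * Rabs (r - t)); [|right; ring].
  apply Rplus_le_compat; [right; exact (norm_scal_abs (r - t) y) | exact N1]. }
change (Rabs (F (x r) - F (x t) - (r - t) * inner (gradF (x t)) y) <= e * Rabs (r - t)).
rewrite E.
replace (_ - _) with (inner (minus w (gradF (x t))) (minus (x r) (x t)) + inner (gradF (x t)) rem)
  by (unfold rem; inner_expand; ring).
eapply Rle_trans; [apply Rabs_triang|].
replace (e * Rabs (r - t)) with (e / (2 * (norm y + 1)) * ((norm y + 1) * Rabs (r - t))
  + (norm (gradF (x t)) + 1) * (e / (2 * (norm (gradF (x t)) + 1)) * Rabs (r - t))) by (field; lra).
apply Rplus_le_compat; (eapply Rle_trans; [apply Cauchy_Schwarz|]);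
  apply Rmult_le_compat; try apply norm_ge_0.
- apply Rlt_le; exact Hw.
- exact Nx.
- lra.
- exact N2.
Qed.

End Trajectory.
End Potential.

(** * Differential inequalities *)

Lemma nonincreasing_of_derive (f f' : R -> R) t0 t :
  (forall r, t0 < r -> is_derive f r (f' r)) -> continuous f t0 ->
  (forall r, t0 < r -> f' r <= 0) -> t0 <= t -> f t <= f t0.
Proof.
intros D C S Ht; destruct (Rle_lt_or_eq_dec _ _ Ht) as [L| ->]; [|lra].
(* The intermediate point may be the endpoint [t0], where nothing is known about [f']; truncating by
   [Rmin 0] gives the right sign there and changes nothing for [r > t0]. *)
destruct (MVT_gen f t0 t (fun r => Rmin 0 (f' r))) as [c [Hc E]];
  rewrite ?Rmin_left, ?Rmax_right in * by lra.
- intros x Hx; rewrite Rmin_right by (apply S; lra); apply D; lra.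
- intros x Hx; apply continuity_pt_filterlim.
  destruct (Rle_lt_or_eq_dec t0 x) as [P| <-]; [lra | | exact C].
  exact (is_derive_continuous (V := R_NormedModule) _ _ _ (D x P)).
- assert (K := Rmin_l 0 (f' c)); nra.
Qed.

(** For abstract functions [auto_derive] leaves differentiability conditions and [Derive] terms;
    this tactic and the next settle both from the [is_derive] facts in context. *)
Ltac differentiable :=
  repeat match goal with |- _ /\ _ => apply conj end;
  first [exact I | eexists; eassumption | lra].

Ltac rewrite_derive :=
  repeat match goal with D : is_derive ?f ?r ?l |- context [Derive ?g ?r] =>
    replace (Derive g r) with l by (symmetry; exact (is_derive_unique f r l D))
  end.

Lemma is_derive_Rpower x t : 0 < t ->
  is_derive (fun r => Rpower r x) t (x / t * Rpower t x).
Proof.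
intros Ht; unfold Rpower; auto_derive; auto; field; lra.
Qed.

Lemma Rpower_pos x y : 0 < Rpower x y.
Proof. apply exp_pos. Qed.

Lemma Rpower_neg_le x y z : 0 < x <= y -> 0 <= z -> Rpower y (- z) <= Rpower x (- z).
Proof.
intros Hx Hz; rewrite !Rpower_Ropp; apply Rinv_le_contravar; [apply Rpower_pos|].
apply Rle_Rpower_l; lra.
Qed.

(* [a], [b], [c], [d], [G] stand for [|u|^2], [<u,u'>], [|u'|^2],
   [|A^(1/2) u|^2] and [F(u)]; [h] is [t^(alpha-2) E_lambda] at
   [lambda = alpha/2], the value for which all terms of [h'] have a sign. *)
Lemma energy_decay s alpha t0 (a b c d G g1 g2 : R -> R) :
  2 < s -> 0 < alpha <= 2 -> 0 < t0 ->
  continuous a t0 -> continuous b t0 -> continuous (fun t => c t + d t) t0 -> continuous G t0 ->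
  (forall t, t0 < t -> is_derive a t (2 * b t)) ->
  (forall t, t0 < t -> is_derive b t (c t - d t - alpha / t * b t - g1 t)) ->
  (forall t, t0 < t -> is_derive (fun t => c t + d t) t (2 * (- (alpha / t) * c t - g2 t))) ->
  (forall t, t0 < t -> is_derive G t (g2 t)) ->
  (forall t, t0 <= t -> 0 <= a t /\ 0 <= c t /\ 0 <= d t /\ 0 <= G t
    /\ b t ^ 2 <= a t * c t /\ s * G t <= g1 t) ->
  exists C, 0 <= C /\ forall t, t0 <= t -> d t + G t <= C * Rpower t (- alpha).
Proof.
intros Hs Ha Ht0 Ca Cb Cn CG Da Db Dn DG Sg.
(* Only the sum of kinetic and elastic energy is known to be differentiable, so it is handled as a
   single function. *)
set (n := fun t => c t + d t) in *.
change (forall t, t0 < t -> is_derive n t (2 * (- (alpha / t) * c t - g2 t))) in Dn.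
set (E := fun t => t ^ 2 * G t + (alpha ^ 2 / 8 + alpha / 4 * (1 - alpha / 2)) * a t
  + alpha / 2 * t * b t + t ^ 2 / 2 * n t).
set (h := fun t => Rpower t (alpha - 2) * E t).
assert (Mono : forall t, t0 <= t -> h t <= h t0).
{ intros t Ht; apply nonincreasing_of_derive with (4 := Ht)
   (f' := fun t => Rpower t (alpha - 2) * (alpha * (t * G t - t / 2 * g1 t) - alpha * (2 - alpha) / (4 * t) * a t)).
  - intros r Hr; unfold h.
    assert (DE : is_derive E r (2 * r * G r + r ^ 2 * g2 r
      + (alpha ^ 2 / 8 + alpha / 4 * (1 - alpha / 2)) * (2 * b r)
      + alpha / 2 * b r + alpha / 2 * r * (c r - d r - alpha / r * b r - g1 r)
      + r * n r + r ^ 2 / 2 * (2 * (- (alpha / r) * c r - g2 r)))).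
    { specialize (Da r Hr); specialize (Db r Hr); specialize (Dn r Hr); specialize (DG r Hr).
      unfold E; clearbody n; auto_derive.
      - differentiable.
      - rewrite_derive.
        field; lra. }
    refine (is_derive_eq _ _ _ _ (is_derive_mult _ _ _ _ _ (is_derive_Rpower (alpha - 2) r ltac:(lra)) DE Rmult_comm) _).
    unfold plus, mult, E, n; simpl; field; lra.
  - apply (continuous_mult (K := R_AbsRing)).
    + exact (is_derive_continuous (V := R_NormedModule) _ _ _ (is_derive_Rpower (alpha - 2) t0 Ht0)).
    + assert (Cp : forall k (f : R -> R), ex_derive k t0 -> continuous f t0 -> continuous (fun t => k t * f t) t0).
      { intros k f Dk Cf; apply (continuous_mult (K := R_AbsRing)); auto.
        now apply (ex_derive_continuous (V := R_NormedModule)). }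
      repeat apply (continuous_plus (V := R_NormedModule)).
      * apply (Cp (fun t => t ^ 2)); auto; auto_derive; auto.
      * apply (Cp (fun _ => alpha ^ 2 / 8 + alpha / 4 * (1 - alpha / 2))); auto; auto_derive; auto.
      * apply (Cp (fun t => alpha / 2 * t)); auto; auto_derive; auto.
      * apply (Cp (fun t => t ^ 2 / 2)); auto; auto_derive; auto.
  - intros r Hr; destruct (Sg r ltac:(lra)) as [S1 [_ [_ [S4 [_ S6]]]]].
    assert (Pp := Rpower_pos r (alpha - 2)).
    assert (Q1 : alpha * (r * G r - r / 2 * g1 r) <= 0).
    { assert (2 * G r <= g1 r) by nra; assert (0 < alpha * r) by nra; nra. }
    assert (Q2 : 0 <= alpha * (2 - alpha) / (4 * r) * a r).
    { apply Rmult_le_pos; auto; apply Rmult_le_pos; [nra|]; apply Rlt_le, Rinv_0_lt_compat; lra. }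
    nra. }
exists (2 * Rabs (h t0)); split; [assert (K := Rabs_pos (h t0)); lra|].
intros t Ht; destruct (Sg t Ht) as [S1 [S2 [S3 [S4 [S5 _]]]]].
assert (Low : t ^ 2 * (G t + d t / 2) <= E t).
{ unfold E, n.
  (* This is [|lambda u + t u'|^2 / 2] in scalar form. Times [a t] it is at least
     [(alpha/2 a + t b)^2 / 2], by [b^2 <= a c]; if [a t = 0] then [b t = 0]. *)
  assert (Sq : 0 <= alpha ^ 2 / 8 * a t + alpha / 2 * t * b t + t ^ 2 / 2 * c t).
  { destruct (Req_dec (a t) 0) as [Z|Z].
    - rewrite Z in S5 |- *; assert (b t = 0) by nra; nra.
    - assert (Pa : 0 < a t) by lra.
      apply Rmult_le_reg_l with (a t); auto; rewrite Rmult_0_r.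
      assert (K := pow2_ge_0 (alpha / 2 * a t + t * b t)); assert (K2 := pow2_ge_0 t); nra. }
  assert (0 <= alpha / 4 * (1 - alpha / 2) * a t) by (apply Rmult_le_pos; [nra|auto]).
  nra. }
assert (Pt := Rpower_pos t (- alpha)); assert (Pt2 := Rpower_pos t (alpha - 2)).
assert (Id : t ^ 2 * (Rpower t (alpha - 2) * Rpower t (- alpha)) = 1).
{ rewrite <- (Rpower_pow 2 t), <- !Rpower_plus by lra.
  replace (INR 2 + (alpha - 2 + - alpha)) with 0 by (simpl; ring); apply Rpower_O; lra. }
assert (Hh := Mono t Ht); assert (Ab := Rle_abs (h t0)).
assert (U : t ^ 2 * (G t + d t / 2) * Rpower t (alpha - 2) <= Rabs (h t0)).
{ apply Rle_trans with (h t); [|lra].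
  unfold h; rewrite Rmult_comm; apply Rmult_le_compat_l; lra. }
apply Rmult_le_compat_r with (r := Rpower t (- alpha)) in U; [|lra].
replace (t ^ 2 * (G t + d t / 2) * Rpower t (alpha - 2) * Rpower t (- alpha))
  with (G t + d t / 2) in U by (rewrite <- (Rmult_1_r (G t + d t / 2)), <- Id at 1; ring).
lra.
Qed.

(* [n] and [m] stand for [|Qu'|^2 + |A^(1/2) u|^2] and [<Qu',Qu>].  The first
   order terms cancel in the derivative of [t^alpha (n + (alpha/t) m)]. *)
Lemma energy_lower_bound alpha mu C delta t0 (n m q d e1 e2 : R -> R) :
  0 < alpha -> 0 < mu -> 0 <= C -> 0 < delta -> 0 < t0 ->
  (forall t, continuous n t) -> (forall t, continuous m t) ->
  (forall t, n t = q t + d t) ->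
  (forall t, t0 < t -> is_derive n t (2 * (- (alpha / t) * q t - e1 t))) ->
  (forall t, t0 < t -> is_derive m t (q t - d t - alpha / t * m t - e2 t)) ->
  (forall t, t0 <= t -> 0 <= q t /\ 0 <= d t /\ Rabs (m t) <= mu * n t
    /\ Rabs (e1 t) <= C * Rpower t (- (1 + delta)) * n t
    /\ Rabs (e2 t) <= mu * (C * Rpower t (- (1 + delta)) * n t)) ->
  0 < n t0 ->
  exists c, 0 < c /\ forall t, t0 <= t -> c * Rpower t (- alpha) <= n t.
Proof.
intros Ha Hmu HC Hdel Ht0 Cn Cm En Dn Dm Bd Pn.
(* From [n' >= - k n], with both decaying coefficients frozen at [t0], follows an exponential lower
   bound that needs no corrector. *)
set (k := 2 * (alpha / t0) + 2 * (C * Rpower t0 (- (1 + delta)))).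
assert (Exp : forall t, t0 <= t -> n t0 * exp (- (k * (t - t0))) <= n t).
{ intros t Ht.
  assert (K : - (n t * exp (k * (t - t0))) <= - (n t0 * exp (k * (t0 - t0)))).
  { apply (nonincreasing_of_derive (fun t => - (n t * exp (k * (t - t0))))
      (fun t => - (exp (k * (t - t0)) * (2 * (- (alpha / t) * q t - e1 t) + k * n t)))); auto.
    - intros r Hr; specialize (Dn r Hr); auto_derive; [differentiable|].
      rewrite_derive; unfold Rminus; ring.
    - apply (continuous_opp (V := R_NormedModule)), (continuous_mult (K := R_AbsRing)); [apply Cn|].
      apply (ex_derive_continuous (V := R_NormedModule)); auto_derive; auto.
    - intros r Hr; destruct (Bd r ltac:(lra)) as [B1 [B2 [_ [B4 _]]]].
      assert (P := exp_pos (k * (r - t0))).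
      assert (Q1 : alpha / r <= alpha / t0).
      { apply Rmult_le_compat_l; [lra|]; apply Rinv_le_contravar; lra. }
      assert (Q2 := Rpower_neg_le t0 r (1 + delta) ltac:(lra) ltac:(lra)).
      assert (Q3 : C * Rpower r (- (1 + delta)) * n r <= C * Rpower t0 (- (1 + delta)) * n r).
      { rewrite En; apply Rmult_le_compat_r; [lra|]; apply Rmult_le_compat_l; lra. }
      assert (Q4 : alpha / r * q r <= alpha / t0 * n r).
      { rewrite En; apply Rmult_le_compat; try lra; apply Rlt_le, Rdiv_lt_0_compat; lra. }
      assert (Q5 := Rle_abs (e1 r)).
      assert (0 <= 2 * (- (alpha / r) * q r - e1 r) + k * n r) by (unfold k; lra).
      nra. }
  rewrite Rminus_diag, Rmult_0_r, exp_0, Rmult_1_r in K.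
  rewrite exp_Ropp; apply Rmult_le_reg_r with (exp (k * (t - t0))); [apply exp_pos|].
  rewrite Rmult_assoc, Rinv_l by (apply Rgt_not_eq, exp_pos); lra. }
(* From [T] on [alpha mu / t <= 1/2], so the corrector is at most [n / 2]. *)
set (T := t0 + 2 * alpha * mu).
assert (HT : t0 < T) by (unfold T; nra).
set (L := fun t => Rpower t alpha * (n t + alpha / t * m t)).
(* A nonpositive antiderivative of [2 alpha mu / t^2 + 5 C t^-(1+delta)], the integrating factor for
   [L]. With [w] the bound on the perturbation, the errors in [L'] add up to at most [t^alpha] times
   [(alpha mu / t^2) n + 2 w + w / 2]; as only [n / 2 <= t^-alpha L] is available, the coefficients
   [1] and [5/2] double. *)
set (Gam := fun t => - (2 * alpha * mu / t) - 5 * C / delta * Rpower t (- delta)).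
assert (HL : forall t, T <= t -> n t / 2 <= n t + alpha / t * m t <= 3 / 2 * n t).
{ intros t Ht; destruct (Bd t ltac:(lra)) as [B1 [B2 [B3 _]]].
  assert (Q : alpha / t * Rabs (m t) <= n t / 2).
  { apply Rle_trans with (alpha / t * (mu * n t)).
    - apply Rmult_le_compat_l; auto; apply Rlt_le, Rdiv_lt_0_compat; lra.
    - replace (alpha / t * (mu * n t)) with (n t * (alpha * mu / t)) by (field; lra).
      apply Rmult_le_compat_l; [rewrite En; lra|].
      apply Rmult_le_reg_r with t; [lra|].
      replace (alpha * mu / t * t) with (alpha * mu) by (field; lra); unfold T in Ht; lra. }
  assert (Pa : 0 < alpha / t) by (apply Rdiv_lt_0_compat; lra).
  assert (R1 := Rle_abs (m t)); assert (R2 := Rle_abs (- m t)); rewrite Rabs_Ropp in R2; nra. }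
assert (Inc : forall t, T <= t -> L T * exp (Gam T) <= L t * exp (Gam t)).
{ intros t Ht; apply Ropp_le_cancel.
  apply (nonincreasing_of_derive (fun t => - (L t * exp (Gam t)))
    (fun t => - (exp (Gam t) * (Rpower t alpha * (- (alpha / t ^ 2) * m t - 2 * e1 t - alpha / t * e2 t)
       + L t * (2 * alpha * mu / t ^ 2 + 5 * C * Rpower t (- (1 + delta))))))); auto.
  - intros r Hr.
    assert (DL : is_derive L r (Rpower r alpha * (- (alpha / r ^ 2) * m r - 2 * e1 r - alpha / r * e2 r))).
    { specialize (Dn r ltac:(lra)); specialize (Dm r ltac:(lra)).
      assert (D : is_derive (fun t => n t + alpha / t * m t) r
        (2 * (- (alpha / r) * q r - e1 r) - alpha / r ^ 2 * m r + alpha / r * (q r - d r - alpha / r * m r - e2 r))).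
      { auto_derive; [differentiable|].
        rewrite_derive; field; lra. }
      refine (is_derive_eq _ _ _ _ (is_derive_mult _ _ _ _ _ (is_derive_Rpower alpha r ltac:(lra)) D Rmult_comm) _).
      unfold plus, mult; simpl; rewrite En; field; lra. }
    assert (DG : is_derive Gam r (2 * alpha * mu / r ^ 2 + 5 * C * Rpower r (- (1 + delta)))).
    { assert (DP := is_derive_Rpower (- delta) r ltac:(lra)).
      unfold Gam; clear - DP Hdel Ht0 HT Hr; auto_derive.
      - differentiable.
      - rewrite_derive.
        replace (- (1 + delta)) with (- delta + - (1)) by ring.
        rewrite Rpower_plus, (Rpower_Ropp r 1), Rpower_1 by lra; field; lra. }
    clearbody L Gam; auto_derive; [differentiable|].
    rewrite_derive; ring.
  - apply (continuous_opp (V := R_NormedModule)), (continuous_mult (K := R_AbsRing)).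
    + apply (continuous_mult (K := R_AbsRing)).
      * exact (is_derive_continuous (V := R_NormedModule) _ _ _ (is_derive_Rpower alpha T ltac:(lra))).
      * apply (continuous_plus (V := R_NormedModule)); [apply Cn|].
        apply (continuous_mult (K := R_AbsRing)); [|apply Cm].
        apply (ex_derive_continuous (V := R_NormedModule)); auto_derive; lra.
    + apply (continuous_comp Gam exp).
      * apply (ex_derive_continuous (V := R_NormedModule)).
        assert (DP := is_derive_Rpower (- delta) T ltac:(lra)).
        unfold Gam; auto_derive; differentiable.
      * apply continuity_pt_filterlim, derivable_continuous_pt, derivable_pt_exp.
  - intros r Hr; destruct (Bd r ltac:(lra)) as [B1 [B2 [B3 [B4 B5]]]].
    destruct (HL r ltac:(lra)) as [L1 L2].
    assert (PG := exp_pos (Gam r)); assert (Pp := Rpower_pos r alpha).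
    assert (Pk := Rpower_pos r (- (1 + delta))).
    assert (Pn' : 0 <= n r) by (rewrite En; lra).
    set (w := C * Rpower r (- (1 + delta)) * n r) in *.
    assert (Pw : 0 <= w) by (unfold w; apply Rmult_le_pos; [apply Rmult_le_pos; lra | auto]).
    assert (I2 : 0 < alpha / r ^ 2) by (apply Rdiv_lt_0_compat; [lra | apply pow_lt; lra]).
    assert (I1 : 0 < alpha / r) by (apply Rdiv_lt_0_compat; lra).
    assert (M1 : alpha / r ^ 2 * m r <= alpha / r ^ 2 * (mu * n r)).
    { apply Rmult_le_compat_l; [lra|]; assert (K := Rle_abs (m r)); lra. }
    assert (M2 : e1 r <= w) by (assert (K := Rle_abs (e1 r)); lra).
    assert (M3 : alpha / r * e2 r <= w / 2).
    { apply Rle_trans with (alpha / r * (mu * w)).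
      - apply Rmult_le_compat_l; [lra|]; assert (K := Rle_abs (e2 r)); lra.
      - replace (alpha / r * (mu * w)) with (w * (alpha * mu / r)) by (field; lra).
        apply Rmult_le_compat_l; [auto|]; apply Rmult_le_reg_r with r; [lra|].
        replace (alpha * mu / r * r) with (alpha * mu) by (field; lra); unfold T in Hr; lra. }
    assert (M4 : (n r + alpha / r * m r) * (2 * alpha * mu / r ^ 2 + 5 * C * Rpower r (- (1 + delta)))
      >= alpha / r ^ 2 * (mu * n r) + 5 / 2 * w).
    { replace (alpha / r ^ 2 * (mu * n r) + 5 / 2 * w)
        with (n r / 2 * (2 * alpha * mu / r ^ 2 + 5 * C * Rpower r (- (1 + delta)))) by (unfold w; field; lra).
      apply Rle_ge, Rmult_le_compat_r; [|exact L1].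
      replace (2 * alpha * mu / r ^ 2) with (2 * (alpha / r ^ 2 * mu)) by (field; lra); nra. }
    unfold L; rewrite Rmult_assoc, <- Rmult_plus_distr_l.
    assert (0 <= - (alpha / r ^ 2) * m r - 2 * e1 r - alpha / r * e2 r
      + (n r + alpha / r * m r) * (2 * alpha * mu / r ^ 2 + 5 * C * Rpower r (- (1 + delta)))) by lra.
    rewrite <- Ropp_0; apply Ropp_le_contravar; apply Rmult_le_pos; [lra | apply Rmult_le_pos; lra]. }
assert (PnT : 0 < n T).
{ apply Rlt_le_trans with (2 := Exp T ltac:(lra)); apply Rmult_lt_0_compat; [auto | apply exp_pos]. }
assert (PLT : 0 < L T).
{ apply Rmult_lt_0_compat; [apply Rpower_pos|]; assert (K := HL T ltac:(lra)); lra. }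
(* [c1] serves on [[t0, T]], where [t^-alpha <= t0^-alpha]. [c2] serves beyond [T]: there
   [L T exp (Gam T) <= L t], and [L t] is at most [3/2 t^alpha n]. *)
set (c1 := n t0 * exp (- (Rabs k * (T - t0))) * Rpower t0 alpha).
set (c2 := 2 / 3 * (L T * exp (Gam T))).
assert (Pc1 : 0 < c1) by (repeat apply Rmult_lt_0_compat; auto using exp_pos, Rpower_pos).
assert (Pc2 : 0 < c2)
  by (apply Rmult_lt_0_compat; [lra | apply Rmult_lt_0_compat; auto using exp_pos]).
exists (Rmin c1 c2); split; [now apply Rmin_glb_lt|].
intros t Ht; assert (Pt := Rpower_pos t (- alpha)).
destruct (Rle_lt_dec T t) as [HTt|HtT].
- apply Rle_trans with (c2 * Rpower t (- alpha)).
  { apply Rmult_le_compat_r; [lra | apply Rmin_r]. }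
  assert (K := Inc t HTt); destruct (HL t HTt) as [_ L2].
  assert (EG : exp (Gam t) <= 1).
  { rewrite <- exp_0.
    assert (Gam t <= 0); [|destruct (Rle_lt_or_eq_dec _ _ H) as [Q| ->]; [left; now apply exp_increasing | lra]].
    assert (P1 : 0 < 2 * alpha * mu / t) by (apply Rdiv_lt_0_compat; nra).
    assert (P2 : 0 <= 5 * C / delta * Rpower t (- delta)).
    { apply Rmult_le_pos; [|apply Rlt_le, Rpower_pos].
      apply Rmult_le_pos; [lra | apply Rlt_le, Rinv_0_lt_compat; lra]. }
    unfold Gam; lra. }
  assert (PLt : 0 <= L t).
  { apply Rmult_le_pos; [apply Rlt_le, Rpower_pos|].
    destruct (Bd t Ht) as [B1 [B2 _]]; rewrite En in *; destruct (HL t HTt) as [L1 _]; rewrite En in L1; lra. }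
  assert (K2 : c2 <= 2 / 3 * L t) by (unfold c2; nra).
  apply Rle_trans with (2 / 3 * L t * Rpower t (- alpha)).
  { apply Rmult_le_compat_r; lra. }
  assert (Id : Rpower t alpha * Rpower t (- alpha) = 1).
  { rewrite <- Rpower_plus, Rplus_opp_r; apply Rpower_O; lra. }
  replace (2 / 3 * L t * Rpower t (- alpha))
    with (2 / 3 * (n t + alpha / t * m t) * (Rpower t alpha * Rpower t (- alpha))) by (unfold L; ring).
  rewrite Id; lra.
- apply Rle_trans with (c1 * Rpower t (- alpha)).
  { apply Rmult_le_compat_r; [lra | apply Rmin_l]. }
  apply Rle_trans with (2 := Exp t Ht).
  assert (Q := Rpower_neg_le t0 t alpha ltac:(lra) ltac:(lra)).
  assert (Id : Rpower t0 alpha * Rpower t0 (- alpha) = 1).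
  { rewrite <- Rpower_plus, Rplus_opp_r; apply Rpower_O; lra. }
  unfold c1; rewrite !Rmult_assoc; apply Rmult_le_compat_l; [lra|].
  apply Rle_trans with (exp (- (Rabs k * (T - t0))) * 1).
  + apply Rmult_le_compat_l; [apply Rlt_le, exp_pos|]; rewrite <- Id.
    apply Rmult_le_compat_l; [apply Rlt_le, Rpower_pos | exact Q].
  + rewrite Rmult_1_r.
    assert (Le : - (Rabs k * (T - t0)) <= - (k * (t - t0))).
    { assert (K1 := Rle_abs k); assert (K2 := Rabs_pos k); nra. }
    destruct (Rle_lt_or_eq_dec _ _ Le) as [Lt| ->]; [left; now apply exp_increasing | lra].
Qed.

(** * The component orthogonal to the kernel *)

Section KernelProjection.
Context {H : HilbertSpace} (A B : operator H) (P : H -> H).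
Hypothesis hA : nonneg_self_adjoint A.
Hypothesis hB : is_sqrt_operator A B.
Hypothesis hP : is_orthogonal_projection (ker A) P.

Definition coproj (x : H) : H := minus x (P x).

(** One direction is [<A x, x> = |B x|^2]; the other holds since [A = B B] with domains. *)
Lemma ker_sqrt x : ker A x <-> dom B x /\ B x = zero.
Proof.
destruct hB as [_ [D E]]; split.
- intros [Dx Ax]; split; [exact (dom_sqrt A B hB x Dx)|].
  apply inner_self_eq0; rewrite <- (sqrt_form A B hB) by (auto; apply (dom_sqrt A B hB); auto).
  rewrite Ax; apply inner_zero_l.
- intros [Dx Bx]; assert (Ax : dom A x) by (apply D; rewrite Bx; auto using dom_zero).
  split; auto; rewrite E, Bx by auto; apply op_zero.
Qed.

Lemma ker_minus x y : ker A x -> ker A y -> ker A (minus x y).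
Proof.
intros [Dx Ax] [Dy Ay]; split; [now apply dom_minus|].
rewrite op_minus, Ax, Ay by auto; vec.
Qed.

Lemma ker_scal a x : ker A x -> ker A (scal a x).
Proof.
intros [Dx Ax]; split; [now apply dom_scal|]; rewrite op_scal, Ax by auto; vec.
Qed.

Lemma inner_coproj_ker x w : ker A w -> inner (coproj x) w = 0.
Proof. intros Hw; exact (proj2 (hP x) w Hw). Qed.

(** [P] is characterized only pointwise; linearity of the complementary projection comes from this
    uniqueness of the orthogonal splitting. *)
Lemma coproj_unique x w : ker A (minus x w) -> orthogonal_to (ker A) w -> coproj x = w.
Proof.
intros K O; apply eq_of_inner_minus.
assert (E : ker A (minus (coproj x) w)).
{ replace (minus (coproj x) w) with (minus (minus x w) (P x)) by (unfold coproj; vec).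
  apply ker_minus; [exact K | apply hP]. }
rewrite inner_minus_l, (inner_coproj_ker x _ E), (O _ E); ring.
Qed.

Lemma coproj_plus x y : coproj (plus x y) = plus (coproj x) (coproj y).
Proof.
apply coproj_unique.
- replace (minus _ _) with (minus (P x) (scal (-1) (P y))) by (unfold coproj; vec).
  apply ker_minus; [apply hP | apply ker_scal, hP].
- intros w Hw; rewrite inner_plus_l, !inner_coproj_ker by auto; ring.
Qed.

Lemma coproj_scal a x : coproj (scal a x) = scal a (coproj x).
Proof.
apply coproj_unique.
- replace (minus _ _) with (scal a (P x)) by (unfold coproj; vec); apply ker_scal, hP.
- intros w Hw; rewrite inner_scal_l, inner_coproj_ker by auto; ring.
Qed.

Lemma inner_coproj_l x y : inner (coproj x) y = inner (coproj x) (coproj y).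
Proof.
unfold coproj at 3; rewrite inner_minus_r, (inner_coproj_ker x (P y)) by apply hP; ring.
Qed.

Lemma inner_coproj_sym x y : inner (coproj x) y = inner x (coproj y).
Proof. now rewrite inner_coproj_l, inner_sym, <- inner_coproj_l, inner_sym. Qed.

Lemma norm_coproj_le x : norm (coproj x) <= norm x.
Proof.
assert (E := norm_sq (coproj x)); rewrite <- inner_coproj_l in E.
assert (K := Rle_trans _ _ _ (Rle_abs _) (Cauchy_Schwarz (coproj x) x)).
assert (P1 := norm_ge_0 (coproj x)); assert (P2 := norm_ge_0 x).
destruct (Req_dec (norm (coproj x)) 0) as [Z|Z]; [rewrite Z; exact P2|].
apply Rmult_le_reg_l with (norm (coproj x)); [lra|].
replace (norm (coproj x) * norm (coproj x)) with (norm (coproj x) ^ 2) by ring; lra.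
Qed.

Lemma is_linear_coproj : is_linear coproj.
Proof.
apply (Build_is_linear (U := H) (V := H)); [exact coproj_plus | exact coproj_scal |].
exists 1; split; [lra | intros x; rewrite Rmult_1_l; exact (norm_coproj_le x)].
Qed.

Lemma continuous_coproj (f : R -> H) t :
  continuous f t -> continuous (fun r => coproj (f r)) t.
Proof.
intros Cf; apply (continuous_comp f coproj); [exact Cf|].
apply (linear_cont coproj), is_linear_coproj.
Qed.

Lemma is_derive_coproj (f : R -> H) t l :
  is_derive f t l -> is_derive (fun r => coproj (f r)) t (coproj l).
Proof.
intros D.
assert (K := filterdiff_comp' f coproj t _ _ D (filterdiff_linear coproj is_linear_coproj)).
apply filterdiff_ext_lin with (1 := K); intros y; apply coproj_scal.
Qed.

Lemma coproj_sqrt x : dom B x -> dom B (coproj x) /\ B (coproj x) = B x.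
Proof.
intros Hx; destruct (proj1 (ker_sqrt (P x)) (proj1 (hP x))) as [D E].
split; [now apply dom_minus|]; unfold coproj; rewrite op_minus, E by auto; vec.
Qed.

Lemma coproj_dom x : dom A x -> dom A (coproj x) /\ A (coproj x) = A x.
Proof.
intros Hx; destruct (proj1 (hP x)) as [D E].
split; [now apply dom_minus|]; unfold coproj; rewrite op_minus, E by auto; vec.
Qed.

Lemma inner_coproj_range x z : dom A z -> inner (coproj x) (A z) = inner x (A z).
Proof.
intros Hz; destruct (proj1 (hP x)) as [D E].
unfold coproj; rewrite inner_minus_l, <- (op_sym A hA (P x) z), E, inner_zero_l by auto; ring.
Qed.

End KernelProjection.

(** * Extension below the initial time, and estimates for real powers *)

Lemma continuous_extension {V : UniformSpace} (f : R -> V) t0 :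
  (forall t, t0 <= t -> filterlim f (at_from t0 t) (locally (f t))) ->
  forall t, continuous (fun r => f (Rmax t0 r)) t.
Proof.
intros Cf t.
apply (filterlim_comp _ _ _ (Rmax t0) f (locally t) (at_from t0 (Rmax t0 t))).
2: apply Cf, Rmax_l.
intros Q [e He]; exists e; intros r Hr.
apply He; [|apply Rmax_l].
change (Rabs (Rmax t0 r - Rmax t0 t) < e); change (Rabs (r - t) < e) in Hr.
apply Rle_lt_trans with (2 := Hr); unfold Rmax.
destruct (Rle_dec t0 r), (Rle_dec t0 t); unfold Rabs; repeat destruct Rcase_abs; lra.
Qed.

(** Raise the hypothesis to the power [(s-2)/s]. [K + 1] replaces [K] to keep the base of [Rpower]
    positive when [K = 0]. *)
Lemma rpow_le v s K t alpha : 0 <= v -> 2 < s -> 0 <= K -> 0 < t ->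
  rpow v s <= K * Rpower t (- alpha) ->
  rpow v (s - 2) <= Rpower (K + 1) ((s - 2) / s) * Rpower t (- (alpha * (s - 2) / s)).
Proof.
intros Hv Hs HK Ht; unfold rpow; destruct (Rlt_dec 0 v) as [Pv|_].
2:{ intros _; apply Rmult_le_pos; apply Rlt_le, Rpower_pos. }
intros Le; assert (Pt := Rpower_pos t (- alpha)).
assert (Le2 : Rpower v s <= (K + 1) * Rpower t (- alpha)) by lra.
assert (E : Rpower v (s - 2) = Rpower (Rpower v s) ((s - 2) / s)).
{ rewrite Rpower_mult; f_equal; field; lra. }
rewrite E; apply Rle_trans with (Rpower ((K + 1) * Rpower t (- alpha)) ((s - 2) / s)).
- apply Rle_Rpower_l; [|split; [apply Rpower_pos | exact Le2]].
  apply Rlt_le, Rdiv_lt_0_compat; lra.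
- rewrite <- Rpower_mult_distr, Rpower_mult by lra.
  right; f_equal; f_equal; field; lra.
Qed.

Lemma rpow_split v s : 0 <= v -> rpow v s = rpow v (s - 2) * v ^ 2.
Proof.
intros Hv; unfold rpow; destruct (Rlt_dec 0 v) as [Pv|Nv].
- rewrite <- (Rpower_pow 2 v), <- Rpower_plus by auto; f_equal; simpl; ring.
- ring.
Qed.

Lemma rpow_le_of_le v w r : 0 <= v <= w -> 0 <= r -> rpow v r <= Rpower w r.
Proof.
intros Hv Hr; unfold rpow; destruct (Rlt_dec 0 v).
- apply Rle_Rpower_l; lra.
- apply Rlt_le, Rpower_pos.
Qed.

(** * The lower bound *)

Section MildSolution.
Context {H : HilbertSpace} (A B : operator H) (P : H -> H) (S S' : R -> H -> H)
  (F : H -> R) (gradF : H -> H) (s : R) (M0 : R -> R) (Rc nu alpha : R).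
Hypothesis hA : nonneg_self_adjoint A.
Hypothesis hB : is_sqrt_operator A B.
Hypothesis hP : is_orthogonal_projection (ker A) P.
Hypothesis hS : solution_operator A B S S'.
Hypothesis hnu : 0 < nu.
Hypothesis hgap : forall v, dom B v -> orthogonal_to (ker A) v ->
  nu * norm v ^ 2 <= norm (B v) ^ 2.
Hypothesis hF : F_assumptions B P F gradF s M0 Rc.
Hypothesis halpha : (s + 2) / (s - 2) <= alpha <= 2.
Context (t0 : R) (u0 u1 : H) (u du : R -> H).
Hypothesis ht0 : 0 < t0.
Hypothesis hdata : ~ (ker A u0 /\ ker A u1).
Hypothesis hu : mild_solution B S S' gradF (fun t => alpha / t) t0 u0 u1 u du.

(* Everything is extended to the whole line by its value at [t0], so that
   one-sided continuity at [t0] becomes continuity. *)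
Let ue t := u (Rmax t0 t).
Let due t := du (Rmax t0 t).
Let fe t := opp (plus (scal (alpha / Rmax t0 t) (due t)) (gradF (ue t))).
Let Q := coproj P.

Let F_diff : F_differentiable B F gradF := proj1 hF.
Let F_lip : F_locally_lipschitz B gradF := proj1 (proj2 hF).

Lemma s_gt2 : 2 < s.
Proof. pose proof hF as [_ [_ [[K _] _]]]; exact K. Qed.

Lemma alpha_pos : 0 < alpha.
Proof.
apply Rlt_le_trans with (2 := proj1 halpha); assert (K := s_gt2); apply Rdiv_lt_0_compat; lra.
Qed.

Lemma ue_dom t : dom B (ue t).
Proof. apply (mild_dom _ _ _ _ _ _ _ _ _ _ hu), Rmax_l. Qed.

Lemma mild_continuous_aux (f : R -> H) t : t0 <= t ->
  (forall r, t0 <= r -> norm (minus (f r) (f t)) <= norm1 B (minus (u r) (u t))) ->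
  filterlim f (at_from t0 t) (locally (f t)).
Proof.
intros Ht Le; refine (proj2 (filterlim_locally_ball_norm (U := H) (F := at_from t0 t) _ _) _); intros e.
assert (K := mild_continuous _ _ _ _ _ _ _ _ _ _ hu t Ht).
assert (K1 := proj1 (filterlim_locally_ball_norm (U := R_NormedModule) (F := at_from t0 t) _ _) K e).
revert K1; unfold at_from, within; apply filter_imp; intros r Hr Pr.
apply Rle_lt_trans with (1 := Le r Pr).
specialize (Hr Pr); change (Rabs (norm1 B (minus (u r) (u t)) - 0) < e) in Hr.
rewrite Rminus_0_r in Hr; apply Rle_lt_trans with (1 := Rle_abs _) (2 := Hr).
Qed.

Lemma norm_le_norm1 v : norm v <= norm1 B v.
Proof.
rewrite (norm_eq_sqrt_sq v); apply sqrt_le_1_alt; assert (K := pow2_ge_0 (norm (B v))); lra.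
Qed.

Lemma norm_sqrt_le_norm1 v : norm (B v) <= norm1 B v.
Proof.
rewrite (norm_eq_sqrt_sq (B v)); apply sqrt_le_1_alt; assert (K := pow2_ge_0 (norm v)); lra.
Qed.

Lemma ue_cont t : continuous ue t.
Proof.
apply continuous_extension; intros r Hr; apply mild_continuous_aux; auto.
intros; apply norm_le_norm1.
Qed.

Lemma Bue_cont t : continuous (fun r => B (ue r)) t.
Proof.
apply (continuous_extension (fun r => B (u r))); intros r Hr; apply (mild_continuous_aux (fun r => B (u r))); auto.
intros q Hq; rewrite <- op_minus by (apply (mild_dom _ _ _ _ _ _ _ _ _ _ hu); auto).
apply norm_sqrt_le_norm1.
Qed.

Lemma due_cont t : continuous due t.
Proof. apply continuous_extension, (mild_derive_continuous _ _ _ _ _ _ _ _ _ _ hu). Qed.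

Lemma fe_cont t : continuous fe t.
Proof.
apply (continuous_opp (V := H)), (continuous_plus (V := H)).
- apply (continuous_scal (V := H)); [|apply due_cont].
  apply (continuous_extension (fun r => alpha / r)); intros r Hr.
  assert (L : filter_le (at_from t0 r) (locally r)) by apply filter_le_within.
  apply (filterlim_filter_le_1 _ L).
  apply (ex_derive_continuous (V := R_NormedModule)); auto_derive; lra.
- apply (continuous_gradF B gradF F_lip); auto using ue_dom, ue_cont, Bue_cont.
Qed.

Lemma ue_derive t : t0 < t -> is_derive ue t (due t).
Proof.
intros Ht; apply is_derive_remainder; intros e He.
destruct (mild_derive _ _ _ _ _ _ _ _ _ _ hu t (Rlt_le _ _ Ht)) as [_ D].
assert (Lim : is_filter_lim (at_from t0 t) t) by (intros X HX; apply filter_le_within, HX).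
generalize (filter_and (F := locally t) _ _ (D t Lim (mkposreal e He)) (open_gt t0 t Ht)).
apply filter_imp; intros r [Dr Hr]; unfold ue, due.
rewrite !(Rmax_right t0) by lra; apply Dr; lra.
Qed.

Lemma ue_duhamel t : t0 <= t -> exists I,
  is_RInt (fun r => S (t - r) (fe r)) t0 t I /\
  ue t = plus (plus (S' (t - t0) u0) (S (t - t0) u1)) I.
Proof.
intros Ht; destruct (mild_duhamel _ _ _ _ _ _ _ _ _ _ hu t Ht) as [I [HI E]].
exists (opp I); split.
- apply is_RInt_ext with (2 := is_RInt_opp _ _ _ _ HI); intros r.
  rewrite Rmin_left, Rmax_right by lra; intros Hr.
  unfold fe, ue, due; rewrite Rmax_right by lra.
  symmetry; exact (linear_opp _ _ (S_bounded _ _ _ _ hS (t - r))).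
- unfold ue; rewrite Rmax_right by auto; exact E.
Qed.

Lemma ue_weak z t : dom A z -> t0 < t ->
  is_derive (fun r => inner (due r) z) t (inner (fe t) z - inner (ue t) (A z)).
Proof.
apply (duhamel_weak A B S S' hA hB hS fe ue due t0 u0 u1 fe_cont ue_derive ue_duhamel).
Qed.

Lemma ue_initial : ue t0 = u0 /\ due t0 = u1.
Proof.
split.
- exact (duhamel_initial_position A B S S' hA hB hS fe ue t0 u0 u1 ue_duhamel).
- exact (duhamel_initial_velocity A B S S' hA hB hS fe ue due t0 u0 u1 fe_cont due_cont ue_derive ue_duhamel).
Qed.

Lemma mild_decay : exists C, 0 <= C /\ forall t, t0 <= t ->
  norm (B (ue t)) ^ 2 + F (ue t) <= C * Rpower t (- alpha).
Proof.
destruct (energy_decay s alpha t0 (fun t => inner (ue t) (ue t)) (fun t => inner (due t) (ue t))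
  (fun t => inner (due t) (due t)) (fun t => inner (B (ue t)) (B (ue t))) (fun t => F (ue t))
  (fun t => inner (gradF (ue t)) (ue t)) (fun t => inner (gradF (ue t)) (due t))) as [C [HC HC']];
  auto using s_gt2.
- assert (K := alpha_pos); lra.
- apply continuous_inner; apply ue_cont.
- apply continuous_inner; [apply due_cont | apply ue_cont].
- apply (continuous_plus (V := R_NormedModule)); apply continuous_inner; auto using due_cont, Bue_cont.
- apply (continuous_F B F gradF F_diff F_lip); auto using ue_dom, ue_cont, Bue_cont.
- intros t Ht; refine (is_derive_eq _ _ _ _ (is_derive_inner _ _ _ _ _ (ue_derive t Ht) (ue_derive t Ht)) _).
  rewrite (inner_sym _ (ue t)); ring.
- intros t Ht; refine (is_derive_eq _ _ _ _ (wave_virial A B hA hB ue due fe t0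
    ue_dom ue_cont Bue_cont due_cont fe_cont ue_derive ue_weak t Ht) _).
  unfold fe; rewrite Rmax_right by lra; inner_expand; ring.
- intros t Ht; refine (is_derive_eq _ _ _ _ (wave_energy A B hA hB ue due fe t0
    ue_dom ue_cont Bue_cont due_cont fe_cont ue_derive ue_weak t Ht) _).
  unfold fe; rewrite Rmax_right by lra; inner_expand; rewrite (inner_sym _ (due t) (gradF _)); ring.
- intros t Ht; apply (is_derive_F B F gradF F_diff F_lip); auto using ue_dom, ue_cont, Bue_cont, ue_derive.
- intros t Ht; repeat split; try apply inner_ge0.
  + apply F_diff, ue_dom.
  + assert (K := Cauchy_Schwarz (due t) (ue t)).
    rewrite <- !norm_sq, <- (pow2_abs (inner _ _)).
    apply Rle_trans with ((norm (due t) * norm (ue t)) ^ 2); [|right; ring].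
    apply pow_incr; split; [apply Rabs_pos | exact K].
  + pose proof hF as [_ [_ [[_ K] _]]]; apply K, ue_dom.
- exists C; split; auto; intros t Ht; rewrite norm_sq; auto.
Qed.

Lemma gradF_decay : exists C, 0 <= C /\ forall t, t0 <= t ->
  norm (Q (gradF (ue t))) <= C * Rpower t (- (1 + 2 / s)) * norm (B (ue t)).
Proof.
destruct mild_decay as [C [HC Dec]].
pose proof hF as [_ [_ [_ [_ [[Mb Co] [PR Rg]]]]]].
assert (Hs := s_gt2); assert (Ha := alpha_pos).
(* The [+ 1] makes [r0 >= 1], so that the bound [r0 - 1] on the square of [norm (B (ue t))] also
   gives [r0] as a bound on the norm; [M0] is then bounded on [[-r0, r0]]. *)
set (r0 := C * Rpower t0 (- alpha) + 1).
assert (Pt0 := Rpower_pos t0 (- alpha)).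
assert (Pr0 : 0 < r0) by (unfold r0; nra).
destruct (Mb r0) as [M HM].
assert (PM : 0 <= M).
{ apply Rle_trans with (2 := HM 0 ltac:(rewrite Rabs_R0; lra)); apply Rabs_pos. }
(* Surplus of the decay exponent over [1 + 2/s], nonnegative by the lower bound on [alpha]; the
   extra factor [t^-e] is absorbed into the constant as [t0^-e]. *)
set (e := alpha * (s - 2) / s - (1 + 2 / s)).
assert (He : 0 <= e).
{ unfold e; apply Rmult_le_reg_r with s; [lra|].
  replace ((alpha * (s - 2) / s - (1 + 2 / s)) * s) with (alpha * (s - 2) - (s + 2)) by (field; lra).
  assert (K := proj1 halpha); apply Rmult_le_compat_r with (r := s - 2) in K; [|lra].
  replace ((s + 2) / (s - 2) * (s - 2)) with (s + 2) in K by (field; lra); lra. }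
set (K1 := M * C); set (K2 := Rpower r0 (s - 2) * C).
assert (PK1 : 0 <= K1) by (apply Rmult_le_pos; auto).
assert (PK2 : 0 <= K2) by (apply Rmult_le_pos; auto; apply Rlt_le, Rpower_pos).
set (k := fun K => Rpower (K + 1) ((s - 2) / s)).
assert (Pk : forall K, 0 < k K) by (intros; apply Rpower_pos).
exists (Rc * (k K1 + k K2) * Rpower t0 (- e)); split.
{ apply Rmult_le_pos; [apply Rmult_le_pos; [lra|] | apply Rlt_le, Rpower_pos].
  assert (X1 := Pk K1); assert (X2 := Pk K2); lra. }
intros t Ht.
assert (Dt := Dec t Ht); assert (PF : 0 <= F (ue t)) by (apply F_diff, ue_dom).
assert (Pt := Rpower_pos t (- alpha)).
assert (Nu := norm_ge_0 (ue t)); assert (NB := norm_ge_0 (B (ue t))).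
assert (Nr : norm (B (ue t)) <= r0).
{ assert (L := Rpower_neg_le t0 t alpha ltac:(lra) ltac:(lra)).
  assert (norm (B (ue t)) ^ 2 <= C * Rpower t0 (- alpha)).
  { apply Rle_trans with (C * Rpower t (- alpha)); [lra | apply Rmult_le_compat_l; auto]. }
  unfold r0; nra. }
assert (U : rpow (norm (ue t)) s <= K1 * Rpower t (- alpha)).
{ apply Rle_trans with (1 := Co _ (ue_dom t)); unfold K1; rewrite Rmult_assoc.
  assert (LM : M0 (norm (B (ue t))) <= M).
  { apply Rle_trans with (1 := Rle_abs _), HM; rewrite Rabs_pos_eq; auto. }
  apply Rle_trans with (M * (norm (B (ue t)) ^ 2 + F (ue t))).
  - apply Rmult_le_compat_r; auto; assert (X := pow2_ge_0 (norm (B (ue t)))); lra.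
  - apply Rmult_le_compat_l; auto. }
(* Write the power as [rpow (norm (B (ue t))) (s - 2)], bounded through [r0], times the square,
   which decays. Thus both norms in (vi) have the same rate. *)
assert (V : rpow (norm (B (ue t))) s <= K2 * Rpower t (- alpha)).
{ rewrite rpow_split by auto; unfold K2; rewrite Rmult_assoc; apply Rmult_le_compat.
  - unfold rpow; destruct (Rlt_dec 0 (norm (B (ue t)))); [apply Rlt_le, Rpower_pos | lra].
  - apply pow2_ge_0.
  - apply rpow_le_of_le; lra.
  - lra. }
apply rpow_le in U; try lra; apply rpow_le in V; try lra.
assert (Ep : Rpower t (- (alpha * (s - 2) / s)) <= Rpower t0 (- e) * Rpower t (- (1 + 2 / s))).
{ replace (- (alpha * (s - 2) / s)) with (- e + - (1 + 2 / s)) by (unfold e; ring).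
  rewrite Rpower_plus; apply Rmult_le_compat_r; [apply Rlt_le, Rpower_pos|].
  apply Rpower_neg_le; lra. }
apply Rle_trans with (1 := Rg _ (ue_dom t)); apply Rmult_le_compat_r; auto.
rewrite !Rmult_assoc; apply Rmult_le_compat_l; [lra|].
apply Rle_trans with ((k K1 + k K2) * Rpower t (- (alpha * (s - 2) / s))).
- rewrite Rmult_plus_distr_r; apply Rplus_le_compat; assumption.
- apply Rmult_le_compat_l; auto; assert (X1 := Pk K1); assert (X2 := Pk K2); lra.
Qed.

Lemma mild_lower_bound : exists c, 0 < c /\ forall t, t0 <= t ->
  c * Rpower t (- alpha) <= energy B F u du t.
Proof.
destruct gradF_decay as [C [HC Dec]].
assert (Hs := s_gt2); assert (Ha := alpha_pos).
(* Dominates the sharp constant [1 / sqrt nu] of the spectral gap, because [(1/nu + 1)^2 >= 1/nu];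
   no square root is needed. *)
set (mu := / nu + 1).
assert (Inu : 0 < / nu) by (apply Rinv_0_lt_compat; auto).
assert (Qd : forall t, dom B (Q (ue t)) /\ B (Q (ue t)) = B (ue t)).
{ intros t; apply (coproj_sqrt A B P hB hP), ue_dom. }
assert (CBQ : forall t, continuous (fun r => B (Q (ue r))) t).
{ intros t; apply continuous_ext with (fun r => B (ue r)); [|apply Bue_cont].
  intros r; symmetry; apply Qd. }
assert (CQu : forall t, continuous (fun r => Q (ue r)) t)
  by (intros; apply (continuous_coproj A P hP), ue_cont).
assert (CQd : forall t, continuous (fun r => Q (due r)) t)
  by (intros; apply (continuous_coproj A P hP), due_cont).
assert (CQf : forall t, continuous (fun r => Q (fe r)) t)
  by (intros; apply (continuous_coproj A P hP), fe_cont).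
assert (DQ : forall t, t0 < t -> is_derive (fun r => Q (ue r)) t (Q (due t)))
  by (intros; now apply (is_derive_coproj A P hP), ue_derive).
(* The weak equation for [Qu] is that for [u] tested with [Qz]: [Q] is symmetric, [A Q z = A z], and
   the range of [A] is orthogonal to its kernel. *)
assert (WQ : forall z t, dom A z -> t0 < t ->
  is_derive (fun r => inner (Q (due r)) z) t (inner (Q (fe t)) z - inner (Q (ue t)) (A z))).
{ intros z t Hz Ht; destruct (coproj_dom A P hP z Hz) as [D1 D2].
  apply is_derive_ext with (fun r => inner (due r) (Q z)).
  - intros r; symmetry; apply (inner_coproj_sym A P hP).
  - unfold Q; rewrite (inner_coproj_sym A P hP), (inner_coproj_range A P hA hP) by auto.
    rewrite <- D2; now apply ue_weak. }
assert (Qfe : forall t, t0 < t -> Q (fe t) = minus (scal (- (alpha / t)) (Q (due t))) (Q (gradF (ue t)))).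
{ intros t Ht; unfold Q, fe; rewrite Rmax_right by lra.
  replace (opp _) with (plus (scal (- (alpha / t)) (due t)) (scal (-1) (gradF (ue t)))) by vec.
  rewrite (coproj_plus A P hP), !(coproj_scal A P hP); vec. }
destruct (energy_lower_bound alpha mu C (2 / s) t0
  (fun t => inner (Q (due t)) (Q (due t)) + inner (B (Q (ue t))) (B (Q (ue t))))
  (fun t => inner (Q (due t)) (Q (ue t)))
  (fun t => inner (Q (due t)) (Q (due t))) (fun t => inner (B (Q (ue t))) (B (Q (ue t))))
  (fun t => inner (Q (due t)) (Q (gradF (ue t)))) (fun t => inner (Q (gradF (ue t))) (Q (ue t))))
  as [c [Hc Low]]; auto.
- unfold mu; lra.
- apply Rdiv_lt_0_compat; lra.
- intros t; apply (continuous_plus (V := R_NormedModule)); apply continuous_inner; auto.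
- intros t; apply continuous_inner; auto.
- intros t Ht; refine (is_derive_eq _ _ _ _ (wave_energy A B hA hB _ _ (fun r => Q (fe r)) t0
    (fun t => proj1 (Qd t)) CQu CBQ CQd CQf DQ WQ t Ht) _).
  cbv beta; rewrite Qfe by auto; inner_expand; ring.
- intros t Ht; refine (is_derive_eq _ _ _ _ (wave_virial A B hA hB _ _ (fun r => Q (fe r)) t0
    (fun t => proj1 (Qd t)) CQu CBQ CQd CQf DQ WQ t Ht) _).
  cbv beta; rewrite Qfe by auto; inner_expand; ring.
- intros t Ht; specialize (Dec t Ht); rewrite (proj2 (Qd t)), <- !norm_sq.
  set (k := C * Rpower t (- (1 + 2 / s))) in *.
  assert (Pk : 0 <= k) by (apply Rmult_le_pos; auto; apply Rlt_le, Rpower_pos).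
  assert (N1 := norm_ge_0 (Q (due t))); assert (N2 := norm_ge_0 (B (ue t))).
  assert (N3 := norm_ge_0 (Q (ue t))); assert (N4 := norm_ge_0 (Q (gradF (ue t)))).
  assert (Gap : norm (Q (ue t)) <= mu * norm (B (ue t))).
  { assert (K := hgap (Q (ue t)) (proj1 (Qd t)) (proj2 (hP (ue t)))).
    rewrite (proj2 (Qd t)) in K.
    apply Rmult_le_compat_l with (r := / nu) in K; [|lra].
    rewrite <- Rmult_assoc, Rinv_l, Rmult_1_l in K by lra.
    unfold mu.
    assert (K2 : norm (Q (ue t)) ^ 2 <= ((/ nu + 1) * norm (B (ue t))) ^ 2).
    { apply Rle_trans with (1 := K); rewrite Rpow_mult_distr.
      apply Rmult_le_compat_r; [apply pow2_ge_0 | nra]. }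
    apply Rsqr_incr_0_var; [unfold Rsqr; nra | apply Rmult_le_pos; lra]. }
  assert (Pmu : 0 < mu) by (unfold mu; lra).
  repeat split; try apply pow2_ge_0; (eapply Rle_trans; [apply Cauchy_Schwarz|]).
  + apply Rle_trans with (norm (Q (due t)) * (mu * norm (B (ue t)))).
    * apply Rmult_le_compat_l; auto.
    * assert (K := pow2_ge_0 (norm (Q (due t)) - norm (B (ue t)))); nra.
  + apply Rle_trans with (norm (Q (due t)) * (k * norm (B (ue t)))).
    * apply Rmult_le_compat_l; auto.
    * assert (K := pow2_ge_0 (norm (Q (due t)) - norm (B (ue t)))); nra.
  + apply Rle_trans with (k * norm (B (ue t)) * (mu * norm (B (ue t)))).
    * apply Rmult_le_compat; auto.
    * replace (k * norm (B (ue t)) * (mu * norm (B (ue t)))) with (mu * (k * norm (B (ue t)) ^ 2)) by ring.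
      apply Rmult_le_compat_l; [lra|]; apply Rmult_le_compat_l; [auto|].
      assert (K := pow2_ge_0 (norm (Q (due t)))); lra.
- rewrite (proj2 (Qd t0)); destruct ue_initial as [-> ->].
  assert (I1 := inner_ge0 _ (Q u1)); assert (I2 := inner_ge0 _ (B u0)).
  destruct (Rle_lt_or_eq_dec _ _ (Rplus_le_le_0_compat _ _ I1 I2)) as [|E]; auto.
  exfalso; apply hdata; split.
  + apply (ker_sqrt A B hB); split; [rewrite <- (proj1 ue_initial); apply ue_dom|].
    apply inner_self_eq0; lra.
  + assert (Z : Q u1 = zero) by (apply inner_self_eq0; lra).
    replace u1 with (P u1); [apply hP|].
    replace u1 with (plus (P u1) (Q u1)) at 2 by (unfold Q, coproj; vec).
    rewrite Z; vec.
- exists (c / 2); split; [lra|]; intros t Ht.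
  specialize (Low t Ht); cbv beta in Low; rewrite (proj2 (Qd t)), <- !norm_sq in Low.
  assert (PF : 0 <= F (ue t)) by (apply F_diff, ue_dom).
  assert (LQ := norm_coproj_le A P hP (due t)); assert (N1 := norm_ge_0 (Q (due t))).
  fold Q in LQ; unfold energy.
  assert (Eu : ue t = u t) by (unfold ue; now rewrite Rmax_right).
  assert (Ed : due t = du t) by (unfold due; now rewrite Rmax_right).
  rewrite <- Eu, <- Ed; nra.
Qed.

End MildSolution.

Theorem theorem4p7
  (H : HilbertSpace) (A B : operator H) (P : H -> H) (S S' : R -> H -> H)
  (F : H -> R) (gradF : H -> H) (s : R) (M0 : R -> R) (Rc : R)
  (nu alpha eps K : R)
  (hA : nonneg_self_adjoint A)
  (hB : is_sqrt_operator A B)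
  (hP : is_orthogonal_projection (ker A) P)
  (hS : solution_operator A B S S')
  (hA0 : nonzero_operator A)
  (hnu : 0 < nu)
  (hgap : forall v, dom B v -> orthogonal_to (ker A) v ->
            nu * norm v ^ 2 <= norm (B v) ^ 2)
  (hF : F_assumptions B P F gradF s M0 Rc)
  (halpha : (s + 2) / (s - 2) <= alpha <= 2)
  (heps : 0 < eps < Rmin (1 / (4 * (s - 2))) (1 / 2))
  (hK : 0 < K) :
  exists Ceps : R, 0 < Ceps /\
  forall (eps1 t0 : R) (u0 u1 : H) (u du : R -> H) (t6 : R),
    0 < eps1 <= Rmin (1 / s ^ 2) ((s - 2) / (2 * s ^ 2 + 3 * s + 2)) ->
    0 < t0 ->
    dom B u0 ->
    ~ (ker A u0 /\ ker A u1) ->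
    mild_solution B S S' gradF (fun t => alpha / t) t0 u0 u1 u du ->
    (forall r, 0 <= r <= sqrt (2 * energy B F u du t0) -> M0 r <= K) ->
    let C1 := C1bar s Rc K in
    let C3 := C3bar nu s Rc K in
    let Hs := H_star B F u du alpha t0 in
    let Ht := H_star_tilde B F u du alpha eps t0 in
    t0 <= t6 ->
    t6 >= (nu ^ 2 + 2 * nu + 3) / (nu * eps1) * alpha
          + rpow (4 * C1 / (eps1 * alpha)
                  * (rpow Hs ((s - 2) / s) + rpow Hs ((s - 2) / 2))) (s / 2)
          + rpow (8 * C1 / (eps1 * alpha)) s
            * rpow (Ht + Ceps * rpow t0 (alpha - 2 * s / (s - 2) - 2 * eps))
                (s - 2) ->
    t6 >= rpow (rpow 2 (s / (s - 2)) * Hs) (s * (s + 2) / (2 * alpha))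
          + rpow (8 * s * C3) s
          + 4 * sqrt (2 * nu + 2) / nu ->
    exists c : R, 0 < c /\
      forall t, t6 <= t -> energy B F u du t >= c * rpow t (- alpha).
Proof.
exists 1; split; [lra|].
intros eps1 t0 u0 u1 u du t6 _ ht0 _ hdata hu _ C1 C3 Hs Ht ht6 _ _.
(* The estimate obtained holds on all of [[t0, +oo)], hence from [t6] on; [rpow] is [Rpower] there
   because [t > 0]. *)
destruct (mild_lower_bound A B P S S' F gradF s M0 Rc nu alpha hA hB hP hS hnu hgap
  hF halpha t0 u0 u1 u du ht0 hdata hu) as [c [Hc Low]].
exists c; split; [exact Hc|]; intros t Ht'.
unfold rpow; destruct (Rlt_dec 0 t); [|lra].
apply Rle_ge, Low; lra.
Qed.
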